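(* Let $A_0\in\mathbb{C}^{n\times n}$ and let $A_0=U_0T_0U_0^*$ be a Schur decomposition of $A_0$. Then there exist constants $K,\varepsilon>0$ (depending on $A_0$ only) such that for every $A\in\mathbb{C}^{n\times n}$ having the same Jordan structure as $A_0$ (that is, $A\in\mathcal{J}(\Omega(A_0))$) and satisfying $\|A-A_0\|<\varepsilon$ there exists a Schur decomposition $A=UTU^*$ of $A$ such that $$\|U-U_0\|+\|T-T_0\|\le K\|A-A_0\|.$$
   Context: A Schur decomposition (Schur factorization) of a matrix $A\in\mathbb{C}^{n\times n}$ is a factorization $A=UTU^*$ with $U\in\mathbb{C}^{n\times n}$ unitary and $T\in\mathbb{C}^{n\times n}$ upper triangular. For $A\in\mathbb{C}^{n\times n}$ and an eigenvalue $\lambda$ of $A$, let $m_1(A,\lambda)\ge m_2(A,\lambda)\ge\dots\ge m_t(A,\lambda)$ be the sizes of all blocks corresponding to $\lambda$ in the Jordan form of $A$, and set $m_i(A,\lambda)=0$ for $i=t+1,\dots,n$. If $A$ has exactly $q$ distinct eigenvalues $\lambda_1,\dots,\lambda_q$, the Jordan structure of $A$ is the unordered collection (with repetitions counted) $\Omega(A)=\{(m_i(A,\lambda_j))_{i=1}^n : j=1,\dots,q\}$. Thus two matrices have the same Jordan structure iff their distinct eigenvalues can be put in bijection so that corresponding eigenvalues have the same Jordan block sizes. $\mathcal{J}(\Omega)$ denotes the set of all matrices with Jordan structure $\Omega$. $\|\cdot\|$ denotes the operator norm on $\mathbb{C}^{n\times n}$ induced by the Euclidean norm. *)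

(* Defs.v *)
From HB Require Import structures.
From mathcomp Require Import all_boot all_order all_algebra.
From mathcomp Require Import boolp classical_sets reals.
From mathcomp Require Import complex.

Set Implicit Arguments.
Unset Strict Implicit.
Unset Printing Implicit Defensive.

Import Order.TTheory GRing.Theory Num.Theory.

Local Open Scope classical_set_scope.
Local Open Scope ring_scope.
Local Open Scope complex_scope.
Local Open Scope sesquilinear_scope.

Section OperatorNorm.
Variable R : realType.

Definition enorm n (x : 'cV[R[i]]_n) : R :=
  Num.sqrt (\sum_i Normc.normc (x i 0) ^+ 2).

Definition opnorm n (A : 'M[R[i]]_n) : R :=
  sup [set enorm (A *m x) | x in [set x : 'cV[R[i]]_n | enorm x <= 1]].

End OperatorNorm.

(* In the library, [is_trig_mx] means LOWER triangular. *)
Definition schur_decomposition (C : numClosedFieldType) n (A U T : 'M[C]_n) :=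
  [/\ U \is unitarymx, is_trig_mx T^T & A = U *m T *m U^t*].

Section JordanStructure.
Variable F : fieldType.

Definition jordan_block (lam : F) (p : nat) : 'M[F]_p :=
  \matrix_(i, j) (lam *+ (i == j) + (i.+1 == j :> nat)%:R).

(* A list of Jordan blocks, each given as (eigenvalue, size). *)
Implicit Types s : seq (F * nat).

Definition block_dim s (k : 'I_(size s)) : nat := (nth (0, 0%N) s k).2.

Definition jordan_mx s : 'M[F]_(\sum_k @block_dim s k) :=
  \mxdiag_(k < size s) jordan_block (nth (0, 0%N) s k).1 (@block_dim s k).

Definition jordan_form n (A : 'M[F]_n) s : Prop :=
  all (fun b => 0 < b.2)%N s /\
  exists (e : (\sum_k @block_dim s k)%N = n) (P : 'M[F]_n),
    P \in unitmx /\ A = P *m castmx (e, e) (jordan_mx s) *m invmx P.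

(* The sequence m_1 >= m_2 >= ... of block sizes for lam, 0-padded to length n. *)
Definition block_sizes n s (lam : F) : seq nat :=
  mkseq (nth 0%N (sort geq [seq b.2 | b <- s & b.1 == lam])) n.

(* The unordered collection Omega(A) is represented by a sequence up to
   [perm_eq]; since the Jordan form is only determined up to the order of its
   blocks, "Om represents Omega(A)" is a relation. *)
Definition jordan_structure n (A : 'M[F]_n) (Om : seq (seq nat)) : Prop :=
  exists s (lams : seq F),
    [/\ jordan_form A s, uniq lams, lams =i eigenvalue A &
        perm_eq Om [seq block_sizes n s lam | lam <- lams]].

Definition jordan_class n (Om : seq (seq nat)) : set 'M[F]_n :=
  [set A | jordan_structure A Om].

End JordanStructure.

(* Main.v *)
From HB Require Import structures.
Require Import Defs.
From mathcomp Require Import all_boot all_order all_algebra.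
From mathcomp Require Import boolp classical_sets reals.
From mathcomp Require Import complex.
From mathcomp Require Import perm.
From mathcomp Require Import ring lra zify.

(** The map from A to a nearby Schur decomposition factors through a similarity
    that is close to the identity.

    Let A be near A0 with the same Jordan structure.  Every eigenvalue x of A0
    has an eigenvalue f(x) of A near it, because det(A - x) is small
    ([eigenvalue_near]); the numbers of eigenvalues being equal, f is a
    bijection between the two spectra ([eigenvalue_matching]).  Rank is lower
    semicontinuous, so that each ker (A - f(x))^k is at most as large as
    ker (A0 - x)^k; the common Jordan structure gives both families of
    dimensions the same sum, hence they agree one by one, and they determine
    the Jordan blocks.  Therefore A is similar to
    B = A0 + sum_x (f(x) - x) E_x, where the E_x are the spectral idempotents of
    A0 ([similar_near], [spectral_family]).  Each E_x is a polynomial in A0,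
    hence so is B; consequently the commutant of B contains that of A0, and B is
    upper triangular in every unitary basis in which A0 is.

    The next point is to find S close to 1 with A S = S B.  The solutions of
    A X - X B = 0 form the kernel of a Sylvester operator, a perturbation of
    X |-> A0 X - X A0, whose kernel contains 1.  Similarity of A and B makes the
    kernel of the first at least as large as that of the second, so no rank is
    gained, and a matrix whose rank does not increase has kernel vectors that
    vary in a Lipschitz way ([kernel_lipschitz]).  This yields |S - 1| =
    O(|A - A0| + |B - A0|) without any choice of Jordan bases
    ([intertwiner_near_1]).

    So far |B - A0|, i.e. the displacement of the eigenvalues, is only known to
    be small.  Taking the trace of E_x (A - A0) S kills all commutators with A0
    and leaves (f(x) - x) tr(E_x S), where tr(E_x S) is close to the
    multiplicity of x; hence |f(x) - x| = O(|A - A0|)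
    ([eigenvalue_shift_lipschitz], [lipschitz_similarity]).

    Finally let A0 = U0 T0 U0^*.  Then A (S U0) = (S U0) T' with T' triangular,
    and the unitary factor of U0^* S U0, which is near 1, is itself
    near 1 ([lq_near_1]); it corrects U0 to the required U
    ([schur_of_intertwiner]).  None of the constants depends on U0.

    All estimates use the entrywise l1 norm, which is submultiplicative also for
    rectangular matrices, and which is compared with the operator norm only in
    the theorem. *)

Set Implicit Arguments.
Unset Strict Implicit.
Unset Printing Implicit Defensive.

Import Order.TTheory GRing.Theory Num.Theory.
Import Normc.

Local Open Scope ring_scope.
Local Open Scope complex_scope.
Local Open Scope sesquilinear_scope.

(** * The entrywise l1 norm *)

(** Locked, so that comparing norms of two large matrices in arithmetic side
    conditions never unfolds the sums. *)
HB.lock Definition l1norm (R : realType) m n (A : 'M[R[i]]_(m, n)) : R :=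
  \sum_i \sum_j normc (A i j).

Section EntryNorm.
Variable R : realType.
Local Notation C := R[i].

Lemma complex_normc (x : C) : (normc x)%:C = `|x|.
Proof. by []. Qed.

Lemma normc_ge0 (x : C) : 0 <= normc x.
Proof. by rewrite -lecR complex_normc normr_ge0. Qed.

Lemma normcD (x y : C) : normc (x + y) <= normc x + normc y.
Proof. exact: le_normcD. Qed.

Lemma normc_opp (x : C) : normc (- x) = normc x.
Proof. exact: normcN. Qed.

Lemma normc_sum (I : Type) (r : seq I) (P : pred I) (F : I -> C) :
  normc (\sum_(i <- r | P i) F i) <= \sum_(i <- r | P i) normc (F i).
Proof.
elim/big_rec2: _ => [|i x y _ le_yx]; first by rewrite normc0.
by apply: le_trans (normcD _ _) _; rewrite lerD2l.
Qed.

Lemma normc_prod (I : Type) (r : seq I) (F : I -> C) :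
  normc (\prod_(i <- r) F i) = \prod_(i <- r) normc (F i).
Proof. by elim/big_rec2: _ => [|i x y _ <-]; rewrite (normc1, normcM). Qed.

Lemma normcX (x : C) k : normc (x ^+ k) = normc x ^+ k.
Proof. by elim: k => [|k IH]; rewrite ?normc1 // !exprS normcM IH. Qed.

Lemma normc_nat (k : nat) : normc (k%:R : C) = k%:R.
Proof. by rewrite -[k%:R]/(1 *+ k) normcMn normc1. Qed.

Lemma normc_conj (x : C) : normc x^* = normc x.
Proof. by case: x => a b; rewrite /= sqrrN. Qed.

Lemma normc_eq0 (x : C) : (normc x == 0) = (x == 0).
Proof. by apply/eqP/eqP => [/eq0_normc//|->]; rewrite normc0. Qed.

Lemma sqr_normc_conj (x : C) : (normc x ^+ 2)%:C = x * x^*.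
Proof. by rewrite -sqr_normc rmorphXn /= complex_normc. Qed.

Lemma l1normE m n (A : 'M[C]_(m, n)) : l1norm A = \sum_i \sum_j normc (A i j).
Proof. by rewrite l1norm.unlock. Qed.

Lemma l1norm_ge0 m n (A : 'M[C]_(m, n)) : 0 <= l1norm A.
Proof. by rewrite l1normE; do 2![apply: sumr_ge0 => ? _]; apply: normc_ge0. Qed.

Lemma l1norm0 m n : l1norm (0 : 'M[C]_(m, n)) = 0.
Proof. by rewrite l1normE; do 2![apply: big1 => ? _]; rewrite mxE normc0. Qed.

Lemma l1norm_entry m n (A : 'M[C]_(m, n)) i j : normc (A i j) <= l1norm A.
Proof.
rewrite !l1normE (bigD1 i) //= (bigD1 j) //= -addrA lerDl addr_ge0 ?sumr_ge0 //.
  by move=> *; apply: normc_ge0.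
by move=> *; apply: sumr_ge0 => *; apply: normc_ge0.
Qed.

Lemma l1norm_eq0 m n (A : 'M[C]_(m, n)) : l1norm A = 0 -> A = 0.
Proof.
move=> A0; apply/matrixP => i j; rewrite mxE; apply: eq0_normc.
by apply/eqP; rewrite eq_le normc_ge0 andbT -A0 l1norm_entry.
Qed.

Lemma l1normD m n (A B : 'M[C]_(m, n)) : l1norm (A + B) <= l1norm A + l1norm B.
Proof.
rewrite !l1normE -big_split /=; apply: ler_sum => i _; rewrite -big_split /=.
by apply: ler_sum => j _; rewrite mxE normcD.
Qed.

Lemma l1normN m n (A : 'M[C]_(m, n)) : l1norm (- A) = l1norm A.
Proof. by rewrite !l1normE; do 2![apply: eq_bigr => ? _]; rewrite mxE normc_opp. Qed.

Lemma l1normB m n (A B : 'M[C]_(m, n)) : l1norm (A - B) <= l1norm A + l1norm B.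
Proof. by rewrite -(l1normN B) l1normD. Qed.

Lemma l1norm_sum m n (I : Type) (r : seq I) (F : I -> 'M[C]_(m, n)) :
  l1norm (\sum_(i <- r) F i) <= \sum_(i <- r) l1norm (F i).
Proof.
elim/big_rec2: _ => [|i x y _ le_yx]; first by rewrite l1norm0.
by apply: le_trans (l1normD _ _) _; rewrite lerD2l.
Qed.

Lemma l1normZ m n a (A : 'M[C]_(m, n)) : l1norm (a *: A) = normc a * l1norm A.
Proof.
rewrite !l1normE mulr_sumr; apply: eq_bigr => i _; rewrite mulr_sumr.
by apply: eq_bigr => j _; rewrite mxE normcM.
Qed.

Lemma l1normM m n p (A : 'M[C]_(m, n)) (B : 'M[C]_(n, p)) :
  l1norm (A *m B) <= l1norm A * l1norm B.
Proof.
rewrite !l1normE mulr_suml; apply: ler_sum => i _.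
apply: (@le_trans _ _ (\sum_j \sum_k normc (A i k) * normc (B k j))).
  apply: ler_sum => j _; rewrite mxE; apply: le_trans (normc_sum _ _ _) _.
  by apply: ler_sum => k _; rewrite normcM.
rewrite exchange_big mulr_suml /=; apply: ler_sum => k _.
rewrite -mulr_sumr ler_wpM2l ?normc_ge0 //.
rewrite (bigD1 k) //= lerDl sumr_ge0 // => *.
by apply: sumr_ge0 => *; apply: normc_ge0.
Qed.

Lemma l1norm_trC m n (A : 'M[C]_(m, n)) : l1norm (A ^t*) = l1norm A.
Proof.
rewrite !l1normE exchange_big; do 2![apply: eq_bigr => ? _].
by rewrite !mxE normc_conj.
Qed.

Lemma l1norm_trmx m n (A : 'M[C]_(m, n)) : l1norm A^T = l1norm A.
Proof. by rewrite !l1normE exchange_big; do 2![apply: eq_bigr => ? _]; rewrite mxE. Qed.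

Lemma l1norm_mxvec m n (A : 'M[C]_(m, n)) : l1norm (mxvec A) = l1norm A.
Proof.
rewrite !l1normE big_ord1 (reindex _ (curry_mxvec_bij _ _)) /=.
by rewrite pair_bigA; apply: eq_bigr => -[i j] _; rewrite mxvecE.
Qed.

Lemma l1norm_tr n (A : 'M[C]_n) : normc (\tr A) <= l1norm A.
Proof.
rewrite l1normE; apply: le_trans (normc_sum _ _ _) _; apply: ler_sum => i _.
rewrite (bigD1 i) //= lerDl; apply: sumr_ge0 => *; exact: normc_ge0.
Qed.

(** Telescoping A^(k+1) - B^(k+1) = A (A^k - B^k) + (A - B) B^k.  The bound M is
    at least 1 so that a power M^k may be replaced by M^(k+1). *)
Lemma l1normXB n (A B : 'M[C]_n) (M : R) k : l1norm A <= M -> l1norm B <= M -> 1 <= M ->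
  l1norm (A ^+ k - B ^+ k) <= k%:R * M ^+ k * l1norm (A - B).
Proof.
move=> leA leB M1; elim: k => [|k IH]; first by rewrite subrr l1norm0 !mul0r.
have M0 : 0 <= M by apply: le_trans M1.
case: (posnP k) => [->|k_gt0].
  by rewrite !expr1 mul1r ler_peMl ?l1norm_ge0.
have leBX j : (0 < j)%N -> l1norm (B ^+ j) <= M ^+ j.
  elim: j => // -[|j] IHj _; first by rewrite !expr1.
  rewrite exprS [leRHS]exprS; apply: le_trans (l1normM _ _) _.
  by rewrite ler_pM ?l1norm_ge0 ?IHj.
have -> : A ^+ k.+1 - B ^+ k.+1 = A *m (A ^+ k - B ^+ k) + (A - B) *m B ^+ k.
  by rewrite mulmxBr mulmxBl addrA subrK !exprS !mulmxE.
apply: le_trans (l1normD _ _) _.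
apply: (@le_trans _ _ (M * (k%:R * M ^+ k * l1norm (A - B)) + l1norm (A - B) * M ^+ k)).
  apply: lerD; apply: le_trans (l1normM _ _) _.
    by rewrite ler_pM ?l1norm_ge0.
  by rewrite ler_pM ?l1norm_ge0 ?leBX.
rewrite -natr1 exprS !mulrDl mul1r; apply: lerD.
  by rewrite le_eqVlt; apply/orP; left; apply/eqP; ring.
rewrite mulrC ler_wpM2r ?l1norm_ge0 // ler_peMl ?exprn_ge0 //.
Qed.

Lemma unitary_entry n (U : 'M[C]_n) i : U \is unitarymx ->
  \sum_j normc (U i j) ^+ 2 = 1.
Proof.
move=> /unitarymxP /matrixP /(_ i i); rewrite !mxE eqxx => UU.
apply: (@complexI R); rewrite rmorph1 -[RHS]UU rmorph_sum /=.
by apply: eq_bigr => j _; rewrite !mxE sqr_normc_conj.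
Qed.

Lemma unitary_le1 n (U : 'M[C]_n) i j : U \is unitarymx -> normc (U i j) <= 1.
Proof.
move=> /(unitary_entry i) UU; rewrite -(@expr_le1 _ 2) ?normc_ge0 // -UU.
by rewrite (bigD1 j) //= lerDl sumr_ge0 // => *; rewrite sqr_ge0.
Qed.

Lemma l1norm_unitary n (U : 'M[C]_n) : U \is unitarymx -> l1norm U <= (n * n)%:R.
Proof.
move=> Uu; apply: (@le_trans _ _ (\sum_(i < n) \sum_(j < n) 1)).
  by rewrite l1normE; do 2![apply: ler_sum => ? _]; apply: unitary_le1.
by under eq_bigr do rewrite sumr_const card_ord; rewrite sumr_const card_ord -mulrnA.
Qed.

(** Comparison of the l1 norm with the operator norm, through their behaviour on
    column vectors. *)
Lemma normc_enorm n (x : 'cV[C]_n) i : normc (x i 0) <= enorm x.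
Proof.
rewrite -[leLHS](@ger0_norm R) ?normc_ge0 // -sqrtr_sqr ler_wsqrtr //.
by rewrite (bigD1 i) //= lerDl sumr_ge0 // => *; rewrite sqr_ge0.
Qed.

Lemma enorm_le_sum n (x : 'cV[C]_n) : enorm x <= \sum_i normc (x i 0).
Proof.
have S0 (P : pred 'I_n) : 0 <= \sum_(i | P i) normc (x i 0).
  by apply: sumr_ge0 => *; apply: normc_ge0.
rewrite -[leRHS](@ger0_norm R) // -sqrtr_sqr ler_wsqrtr //.
rewrite expr2 mulr_suml; apply: ler_sum => i _.
rewrite expr2 ler_wpM2l ?normc_ge0 // (bigD1 i) //= lerDl; exact: S0.
Qed.

Lemma enorm_mul n (A : 'M[C]_n) x : enorm x <= 1 -> enorm (A *m x) <= l1norm A.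
Proof.
move=> x1; rewrite l1normE; apply: le_trans (enorm_le_sum _) _; apply: ler_sum => i _.
rewrite mxE; apply: le_trans (normc_sum _ _ _) _; apply: ler_sum => j _.
by rewrite normcM ler_piMr ?normc_ge0 // (le_trans (normc_enorm _ _)).
Qed.

Lemma opnorm_le_l1norm n (A : 'M[C]_n) : opnorm A <= l1norm A.
Proof.
apply: ge_sup => [|_ [x /= x1 <-]]; last exact: enorm_mul.
exists (enorm (A *m 0)), 0 => //=; rewrite /enorm big1 ?sqrtr0 // => i _.
by rewrite mxE normc0 expr0n.
Qed.

Lemma opnorm_ge0 n (A : 'M[C]_n) : 0 <= opnorm A.
Proof.
apply: (@le_trans _ _ (enorm (A *m 0))); first exact: sqrtr_ge0.
apply: ub_le_sup; first by exists (l1norm A) => _ [x /= x1 <-]; exact: enorm_mul.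
by exists 0 => //=; rewrite /enorm big1 ?sqrtr0 // => i _; rewrite mxE normc0 expr0n.
Qed.

Lemma l1norm_le_opnorm n (A : 'M[C]_n) : l1norm A <= (n * n)%:R * opnorm A.
Proof.
apply: (@le_trans _ _ (\sum_(i < n) \sum_(j < n) opnorm A)); last first.
  under eq_bigr do rewrite sumr_const card_ord.
  by rewrite sumr_const card_ord -mulrnA mulr_natl.
rewrite l1normE; apply: ler_sum => i _; apply: ler_sum => j _.
have -> : A i j = (A *m (delta_mx j 0 : 'cV_n)) i 0.
  by rewrite -colE mxE.
apply: le_trans (normc_enorm _ _) _; apply: ub_le_sup.
  by exists (l1norm A) => _ [x /= x1 <-]; exact: enorm_mul.
exists (delta_mx j 0) => //=; rewrite /enorm (bigD1 j) //= big1.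
  by rewrite mxE !eqxx normc1 expr1n addr0 sqrtr1.
by move=> k /negPf kj; rewrite mxE kj normc0 expr0n.
Qed.

End EntryNorm.

Section ConstantRank.
Variable R : realType.
Local Notation C := R[i].

(** * Kernels of perturbed matrices *)

(** A row x with x (1 + E) = 0 satisfies x = - x E, which is shorter than x. *)
Lemma unitmx_1D n (E : 'M[C]_n) : l1norm E < 1 -> 1%:M + E \in unitmx.
Proof.
move=> E1; rewrite -row_free_unit -kermx_eq0; apply/eqP/row_matrixP => i.
have /sub_kermxP := row_sub i (kermx (1%:M + E)); rewrite row0.
set x := row i _; rewrite mulmxDr mulmx1 => /eqP; rewrite addr_eq0 => /eqP xE.
apply: l1norm_eq0; apply/eqP; rewrite eq_le l1norm_ge0 andbT.
have := l1normM x E; rewrite -l1normN -xE; have := l1norm_ge0 x; nra.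
Qed.

(** With G the pseudo-inverse of B0, the factor 1 + (B - B0) G is close to 1 and
    moves the columns of B0 into the column space of B. *)
Lemma perturbed_mul m n (B0 B : 'M[C]_(m, n)) :
  (1%:M + (B - B0) *m pinvmx B0) *m B0 = B *m (pinvmx B0 *m B0).
Proof.
rewrite mulmxDl mul1mx mulmxBl mulmxBl (mulmxKpV (submx_refl B0)) addrC subrK.
by rewrite -mulmxA.
Qed.

Lemma rank_lsc m n (B0 B : 'M[C]_(m, n)) :
  l1norm ((B - B0) *m pinvmx B0) < 1 -> (\rank B0 <= \rank B)%N.
Proof.
move=> /unitmx_1D; have := perturbed_mul B0 B; set M := 1%:M + _ => MB Mu.
have <- : \rank (M *m B0) = \rank B0 by rewrite eqmxMfull ?row_full_unit.
by rewrite MB mxrankM_maxl.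
Qed.

(** When the rank does not increase, the columns of M B0 fill the column space of
    B, where M = 1 + (B - B0) G; hence B = M B0 Z, and v0 M^-1 is killed by B
    as soon as v0 is killed by B0. *)
Lemma kernel_lipschitz m n p (B0 B : 'M[C]_(m, n)) (v0 : 'M[C]_(p, m)) :
  l1norm ((B - B0) *m pinvmx B0) <= 2^-1 -> (\rank B <= \rank B0)%N ->
  v0 *m B0 = 0 ->
  exists2 v : 'M_(p, m), v *m B = 0 &
    l1norm (v - v0) <= 2 * l1norm v0 * l1norm ((B - B0) *m pinvmx B0).
Proof.
set E := _ *m pinvmx B0 => E12 rB vB0.
have Mu : 1%:M + E \in unitmx by apply: unitmx_1D; lra.
have := perturbed_mul B0 B; rewrite -/E; set M := 1%:M + E in Mu * => MB.
have rM : \rank (M *m B0) = \rank B0 by rewrite eqmxMfull ?row_full_unit.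
have /submxP[Z BZ] : (B^T <= (M *m B0)^T)%MS.
  rewrite -(geq_leqif (mxrank_leqif_sup _)) ?mxrank_tr ?rM //.
  by rewrite MB trmx_mul submxMl.
exists (v0 *m invmx M).
  rewrite -[B]trmxK BZ trmx_mul trmxK !mulmxA mulmxKV //.
  by rewrite vB0 mul0mx.
set v := v0 *m invmx M; have vv0 : v - v0 = - (v *m E).
  by rewrite -[v0 in LHS](mulmxKV Mu) -/v mulmxDr mulmx1 opprD addrA subrr sub0r.
have vE := l1normM v E; rewrite vv0 l1normN.
have v_le : l1norm v <= l1norm v0 + l1norm (v *m E).
  by rewrite -[X in l1norm X <= _](subrK v0) vv0 addrC; apply: l1normB.
have v_ge := l1norm_ge0 v; have E_ge := l1norm_ge0 E.
have v_half : l1norm v * l1norm E <= l1norm v * 2^-1 by rewrite ler_wpM2l.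
have v_2 : l1norm v <= 2 * l1norm v0 by lra.
by apply: le_trans vE _; rewrite ler_wpM2r.
Qed.

Lemma l1norm_lin_mx m n p q (f : {linear 'M[C]_(m, n) -> 'M[C]_(p, q)}) c :
  (forall X, l1norm (f X) <= c * l1norm X) -> l1norm (lin_mx f) <= (m * n)%:R * c.
Proof.
move=> fc; apply: (@le_trans _ _ (\sum_(r < m * n) c)); last first.
  by rewrite sumr_const card_ord mulr_natl.
rewrite l1normE; apply: ler_sum => r _.
have -> : \sum_j normc (lin_mx f r j) = l1norm (row r (lin_mx f)).
  by rewrite l1normE big_ord1; apply: eq_bigr => j _; rewrite [in RHS]mxE.
rewrite rowE mul_rV_lin l1norm_mxvec; apply: le_trans (fc _) _.
rewrite -l1norm_mxvec vec_mxK l1normE big_ord1 (bigD1 r) //= big1.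
  by rewrite mxE !eqxx normc1 addr0 mulr1.
by move=> j /negPf jr; rewrite mxE jr andbF normc0.
Qed.

(** The operator X |-> A X - X B, as a matrix acting on the vectorised X. *)
Definition sylv n (A B : 'M[C]_n) : 'M_(n * n) := lin_mulmx A - lin_mulmxr B.

Lemma mul_sylv n (A B X : 'M[C]_n) :
  mxvec X *m sylv A B = mxvec (A *m X - X *m B).
Proof. by rewrite mulmxBr !mul_vec_lin raddfB. Qed.

Lemma sylv_kerP n (A B X : 'M[C]_n) :
  (mxvec X *m sylv A B = 0) <-> A *m X = X *m B.
Proof.
rewrite mul_sylv; split=> [|->]; last by rewrite subrr linear0.
by move=> /(canRL mxvecK); rewrite linear0 => /eqP; rewrite subr_eq0 => /eqP.
Qed.

Lemma l1norm_sylvB n (A B A0 B0 : 'M[C]_n) :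
  l1norm (sylv A B - sylv A0 B0) <= (n * n)%:R * (l1norm (A - A0) + l1norm (B - B0)).
Proof.
have subACA (V : zmodType) (a b a0 b0 : V) : a - b - (a0 - b0) = a - a0 - (b - b0).
  by rewrite !opprB addrACA [RHS]addrACA [- b + _]addrC.
have -> : sylv A B - sylv A0 B0 = lin_mulmx (A - A0) - lin_mulmxr (B - B0).
  rewrite /sylv subACA; congr (_ - _); apply: esym; exact: linearB.
apply: le_trans (l1normB _ _) _; rewrite mulrDr lerD //; apply: l1norm_lin_mx => X.
  exact: l1normM.
by rewrite mulrC; apply: l1normM.
Qed.

Lemma rank_le_of_kernel m n (B0 B : 'M[C]_(m, n)) (L : 'M_m) :
  row_free L -> kermx B0 *m L *m B = 0 -> (\rank B <= \rank B0)%N.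
Proof.
move=> Lfree /sub_kermxP/mxrankS; rewrite (mxrankMfree _ Lfree).
rewrite (mxrank_ker B0) (mxrank_ker B).
by rewrite (leq_sub2lE _ (rank_leq_row B)).
Qed.

(** Left multiplication by W carries the solutions of B X = X B, among which are
    all the X commuting with A0, to solutions of A X = X B. *)
Lemma rank_sylv_le n (A0 A B W : 'M[C]_n) : W \in unitmx ->
  A *m W = W *m B -> (forall X, A0 *m X = X *m A0 -> B *m X = X *m B) ->
  (\rank (sylv A B) <= \rank (sylv A0 A0))%N.
Proof.
move=> Wu AW cAB; apply: (@rank_le_of_kernel _ _ _ _ (lin_mulmx W)).
  apply/row_freeP; exists (lin_mulmx (invmx W)); apply/row_matrixP => i.
  rewrite !rowE mulmxA -[delta_mx _ _]vec_mxK !mul_vec_lin /=.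
  by rewrite mulKmx // mulmx1.
apply/row_matrixP => i; rewrite row0 2!row_mul.
have : row i (kermx (sylv A0 A0)) *m sylv A0 A0 = 0.
  by apply/sub_kermxP; apply: row_sub.
rewrite -[row i _]vec_mxK mul_vec_lin /= => /sylv_kerP/cAB cX.
by apply/sylv_kerP; rewrite mulmxA AW -!mulmxA cX.
Qed.

(** The identity solves A0 X = X A0; since the Sylvester operator of A and B has
    no larger rank, it has a solution near the identity.  The matrix W, on which
    the constant K does not depend, witnesses that A and B are similar. *)
Lemma intertwiner_near_1 n (A0 : 'M[C]_n) : exists2 K : R, 0 < K &
  forall A B W : 'M_n, W \in unitmx -> A *m W = W *m B ->
  (forall X, A0 *m X = X *m A0 -> B *m X = X *m B) ->
  K * (l1norm (A - A0) + l1norm (B - A0)) <= 1 ->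
  exists2 S : 'M_n, A *m S = S *m B & l1norm (S - 1%:M) <= K * (l1norm (A - A0) + l1norm (B - A0)).
Proof.
pose G := pinvmx (sylv A0 A0).
pose c := (n * n)%:R * l1norm G; pose e := l1norm (1%:M : 'M[C]_n).
have c_ge : 0 <= c by rewrite mulr_ge0 ?ler0n ?l1norm_ge0.
have e_ge : 0 <= e by apply: l1norm_ge0.
have ce_ge : 0 <= c * e by rewrite mulr_ge0.
exists (2 * c * (e + 1) + 1) => [|A B W Wu AW cAB]; first by lra.
set d := l1norm (A - A0) + _ => small.
have d_ge : 0 <= d by rewrite addr_ge0 ?l1norm_ge0.
have EG : l1norm ((sylv A B - sylv A0 A0) *m G) <= c * d.
  apply: le_trans (l1normM _ _) _; rewrite /c mulrAC ler_wpM2r ?l1norm_ge0 //.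
  exact: l1norm_sylvB.
have c_d : 0 <= c * d by rewrite mulr_ge0.
have ecd : 0 <= e * (c * d) by rewrite mulr_ge0.
have [|||v vB v1] := @kernel_lipschitz _ _ 1 (sylv A0 A0) (sylv A B) (mxvec 1%:M).
- by nra.
- exact: rank_sylv_le AW cAB.
- by apply/sylv_kerP; rewrite mulmx1 mul1mx.
exists (vec_mx v); first by apply/sylv_kerP; rewrite vec_mxK.
rewrite -l1norm_mxvec linearB /= vec_mxK; apply: le_trans v1 _.
by rewrite l1norm_mxvec -/e -/G; nra.
Qed.

End ConstantRank.

Section Triangular.

(** * Triangular matrices and orthonormalisation near the identity *)
Lemma trig_mx_mul (F : pzRingType) n (A B : 'M[F]_n) :
  is_trig_mx A -> is_trig_mx B -> is_trig_mx (A *m B).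
Proof.
move=> /is_trig_mxP At /is_trig_mxP Bt; apply/is_trig_mxP => i j ij.
rewrite mxE big1 // => k _; case: (ltnP i k) => [ik|ki].
  by rewrite At ?mul0r.
by rewrite Bt ?mulr0 // (leq_ltn_trans ki).
Qed.

Lemma trig_mx_inv (F : fieldType) n (L : 'M[F]_n) :
  is_trig_mx L -> L \in unitmx -> is_trig_mx (invmx L).
Proof.
move=> Ltr; rewrite unitmxE unitfE det_trig // => /prodf_neq0 Ld.
have Lu : L \in unitmx.
  by rewrite unitmxE unitfE det_trig //; apply/prodf_neq0.
apply/is_trig_mxP => i; have [k ik] := ubnP (i : nat).
elim: k => // k IH in i ik * => j ij.
have /matrixP/(_ i j) := mulmxV Lu; rewrite !mxE (bigD1 i) //= big1 => [|l li].
  rewrite addr0 -val_eqE (ltn_eqF ij) => /eqP.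
  by rewrite mulf_eq0 (negPf (Ld i isT)) => /eqP.
case: (ltngtP i l) => [il|li'|/val_inj il]; last by rewrite il eqxx in li.
  by rewrite (is_trig_mxP Ltr) ?mul0r.
by rewrite IH ?mulr0 //; [apply: leq_trans li' ik | apply: ltn_trans li' ij].
Qed.

End Triangular.

Section QR.
Variable R : realType.
Local Notation C := R[i].

(** Row i of A lies in the span of the first i + 1 orthonormalised rows, hence is
    orthogonal to the later ones. *)
Lemma schmidt_trig n (A : 'M[C]_n) : is_trig_mx (A *m (schmidt A)^t*).
Proof.
apply/is_trig_mxP => i j ij.
pose e := (schmidt A)^t* *m delta_mx j 0 : 'cV_n.
have -> : (A *m (schmidt A)^t*) i j = (row i A *m e) 0 0.
  by rewrite /e mulmxA -row_mul -colE [RHS]mxE [RHS]mxE.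
suff /sub_kermxP -> : (row i A <= kermx e)%MS by rewrite mxE.
apply: submx_trans (row_schmidt_sub A i) _; apply/sumsmx_subP => k ki.
rewrite genmxE; apply/sub_kermxP; rewrite /e mulmxA -row_mul -colE.
have /unitarymxP -> := @schmidt_unitarymx C n n A (leqnn n).
apply/matrixP => a b; rewrite !mxE -val_eqE /= ltn_eqF //.
exact: leq_ltn_trans ki ij.
Qed.

Lemma schmidt_diag_ge0 n (A : 'M[C]_n) i : 0 <= (A *m (schmidt A)^t*) i i.
Proof.
apply: le_trans (form1_row_schmidt A i) _; rewrite dotmxE.
rewrite le_eqVlt; apply/orP; left; apply/eqP; rewrite !mxE.
by apply: eq_bigr => k _; rewrite !mxE.
Qed.

(** For W = 1 + F = L V: the identity V^* = L - F V^* shows that V^* agrees with a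
    lower triangular matrix up to O(F), and V = L^-1 + L^-1 F shows the same for
    V.  So all off-diagonal entries of V are O(F).  The rows of V being
    unit vectors, its diagonal entries have modulus 1 up to O(F), and they are
    close to the entries of L, which are nonnegative reals. *)
Lemma lq_near_1 n : exists2 K : R, 0 < K & forall W : 'M[C]_n,
  l1norm (W - 1%:M) <= 2^-1 -> exists L V : 'M_n,
  [/\ V \is unitarymx, is_trig_mx L, L \in unitmx, W = L *m V &
      l1norm (V - 1%:M) <= K * l1norm (W - 1%:M)].
Proof.
pose c : R := (n * n)%:R; have c_ge : 0 <= c by apply: ler0n.
pose d : R := n%:R * (2 * c); have d_ge : 0 <= d by rewrite !mulr_ge0 ?ler0n.
exists (c * (2 * c + d) + 1) => [|W].
  by rewrite ltr_wpDl // mulr_ge0 // addr_ge0 ?mulr_ge0.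
set F := W - 1%:M => F12.
move: (schmidt_unitarymx W (leqnn n)) (schmidt_trig W) (schmidt_diag_ge0 W).
move: (schmidt W) => V; set L := W *m V^t* => Vu Ltr Ldiag.
have WF : W = 1%:M + F by rewrite addrC subrK.
have Wu : W \in unitmx by rewrite WF; apply: unitmx_1D; lra.
have Vtu : V^t* \is unitarymx by rewrite trmxC_unitary.
have Lu : L \in unitmx by rewrite unitmx_mul Wu; apply: unitarymx_unit Vtu.
have WLV : W = L *m V by rewrite (mulmxKtV _ Vu).
have nV : l1norm V <= c by apply: l1norm_unitary Vu.
have nVt : l1norm (V^t*) <= c by rewrite l1norm_trC.
have F_ge : 0 <= l1norm F by apply: l1norm_ge0.
have VtL : V^t* - L = - (F *m V^t*).
  by rewrite /L WF mulmxDl mul1mx opprD addrA subrr sub0r.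
have FV : l1norm (F *m V^t*) <= c * l1norm F.
  by apply: le_trans (l1normM _ _) _; rewrite mulrC ler_wpM2r.
have VL : V - invmx L = invmx L *m F.
  by rewrite -[V](mulKmx Lu) -WLV WF mulmxDr mulmx1 addrC addKr.
have nL : l1norm (invmx L) <= 2 * c.
  have : l1norm (invmx L) <= l1norm V + l1norm (invmx L *m F).
    by rewrite -VL -{1}(subKr V (invmx L)); apply: l1normB.
  have := l1normM (invmx L) F; have := l1norm_ge0 (invmx L) => L_ge L_F L_V.
  have : l1norm (invmx L) * l1norm F <= l1norm (invmx L) * 2^-1 by rewrite ler_wpM2l.
  by lra.
have LF : l1norm (invmx L *m F) <= 2 * c * l1norm F.
  by apply: le_trans (l1normM _ _) _; rewrite ler_wpM2r.
have VtE i j : (V^t*) i j = (V j i)^* by rewrite !mxE.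
have offdiag i j : i != j -> normc (V i j) <= 2 * c * l1norm F.
  rewrite neq_ltn => /orP[ij|ji].
    have /matrixP/(_ i j) := VL; rewrite [LHS]mxE [(- invmx L) i j]mxE.
    rewrite (is_trig_mxP (trig_mx_inv Ltr Lu)) // subr0 => ->.
    exact: le_trans (l1norm_entry _ _ _) LF.
  have /matrixP/(_ j i) := VtL; rewrite [LHS]mxE [(- L) j i]mxE.
  rewrite (is_trig_mxP Ltr) // subr0 => VE.
  rewrite -normc_conj -VtE VE mxE normc_opp; apply: le_trans (l1norm_entry _ _ _) _.
  have := mulr_ge0 c_ge F_ge; lra.
have diag i : normc (V i i - 1) <= (2 * c + d) * l1norm F.
  set a := normc (L i i); set v := normc (V i i).
  have La : L i i = a%:C by rewrite complex_normc ger0_norm ?Ldiag.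
  have cF_ge := mulr_ge0 c_ge F_ge.
  have VLi : normc ((V i i)^* - L i i) <= c * l1norm F.
    have /matrixP/(_ i i) := VtL; rewrite [LHS]mxE [(- L) i i]mxE VtE => ->.
    by rewrite mxE normc_opp; apply: le_trans (l1norm_entry _ _ _) FV.
  have v_le : v <= a + c * l1norm F.
    rewrite /v -normc_conj -[X in normc X](subrK (L i i)) addrC.
    by apply: le_trans (normcD _ _) _; rewrite lerD2l.
  have a_le : a <= v + c * l1norm F.
    rewrite /a -[L i i](subKr (V i i)^*); apply: le_trans (normcD _ _) _.
    by rewrite normc_conj normc_opp lerD2l.
  have v_le1 : v <= 1 by apply: unitary_le1 Vu.
  have v_ge : 0 <= v by apply: normc_ge0.
  (* 1 - v <= 1 - v^2, the squared length of the rest of the i-th row. *)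
  have v_ge1 : 1 - v <= d * l1norm F.
    have := unitary_entry i Vu; rewrite (bigD1 i) //= -/v => V1.
    have : \sum_(j | j != i) normc (V i j) ^+ 2 <= \sum_(j < n) 2 * c * l1norm F.
      rewrite big_mkcond; apply: ler_sum => j _.
      case: ifP => [ji|_]; last by rewrite -mulrA mulr_ge0.
      apply: (@le_trans _ _ (normc (V i j))); last by rewrite offdiag // eq_sym.
      by rewrite expr2 (ler_piMl (normc_ge0 _)) //; apply: unitary_le1 Vu.
    rewrite sumr_const card_ord -[_ *+ n]mulr_natl mulrA -/d.
    have : v ^+ 2 <= v by rewrite expr2 ler_piMl.
    by lra.
  have := normcD ((V i i)^* - L i i) (L i i - 1); rewrite addrA subrK.
  have -> : (V i i)^* - 1 = (V i i - 1)^* by rewrite rmorphB rmorph1.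
  rewrite normc_conj.
  have -> : normc (L i i - 1) = `|a - 1|.
    by rewrite La -(rmorph1 (real_complex R)) -rmorphB /= expr0n addr0 sqrtr_sqr.
  have : `|a - 1| <= c * l1norm F + d * l1norm F by rewrite ler_norml; apply/andP; lra.
  by lra.
exists L, V; split; [exact: Vu | exact: Ltr | exact: Lu | exact: WLV | ].
apply: (@le_trans _ _ (\sum_(i < n) \sum_(j < n) (2 * c + d) * l1norm F)).
  rewrite l1normE; apply: ler_sum => i _; apply: ler_sum => j _; rewrite !mxE.
  case: eqVneq => [<-|ij]; first exact: diag.
  rewrite subr0; apply: le_trans (offdiag _ _ ij) _.
  by rewrite ler_wpM2r // lerDl.
under eq_bigr do rewrite sumr_const card_ord.
by rewrite sumr_const card_ord -mulrnA -mulr_natl -/c; lra.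
Qed.

End QR.

Section HSim.
Variable F : fieldType.

(** * Similarity and block-diagonal matrices *)

(** Similarity of square matrices whose sizes are equal but possibly not
    convertible, so that block decompositions can be regrouped and permuted
    without casts. *)
Definition hsim m n (A : 'M[F]_m) (B : 'M[F]_n) : Prop :=
  exists (P : 'M_(m, n)) (Q : 'M_(n, m)),
    [/\ P *m Q = 1%:M, Q *m P = 1%:M & A *m P = P *m B].

Lemma hsim_refl n (A : 'M_n) : hsim A A.
Proof. by exists 1%:M, 1%:M; rewrite !mulmx1 mul1mx. Qed.

Lemma hsim_sym m n (A : 'M_m) (B : 'M_n) : hsim A B -> hsim B A.
Proof.
move=> [P [Q [PQ QP AP]]]; exists Q, P; split=> //.
by rewrite -[B *m Q]mul1mx -QP -mulmxA (mulmxA P) -AP -!mulmxA PQ mulmx1.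
Qed.

Lemma hsim_trans m n p (B : 'M_n) (A : 'M_m) (D : 'M_p) :
  hsim A B -> hsim B D -> hsim A D.
Proof.
move=> [P [Q [PQ QP AP]]] [P' [Q' [PQ' QP' BP]]]; exists (P *m P'), (Q' *m Q).
split; first by rewrite mulmxA -(mulmxA P) PQ' mulmx1.
  by rewrite mulmxA -(mulmxA Q') QP mulmx1.
by rewrite mulmxA AP -!mulmxA BP.
Qed.

Lemma hsim_cast m n (e : m = n) (A : 'M_m) : hsim A (castmx (e, e) A).
Proof. by case: n / e; rewrite castmx_id; apply: hsim_refl. Qed.

Lemma hsim_castl m n p (e : m = n) (A : 'M_m) (B : 'M_p) :
  hsim A B -> hsim (castmx (e, e) A) B.
Proof. by apply/hsim_trans/hsim_sym/hsim_cast. Qed.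

Lemma hsim_unit n (A B P : 'M_n) :
  P \in unitmx -> A = P *m B *m invmx P -> hsim A B.
Proof.
move=> Pu ->; exists P, (invmx P).
by rewrite mulmxV // mulVmx // mulmxKV.
Qed.

Lemma hsim_size m n (A : 'M_m) (B : 'M_n) : hsim A B -> m = n.
Proof.
move=> [P [Q [PQ QP _]]]; apply/eqP; rewrite eqn_leq.
rewrite -[m in (m <= _)%N](mxrank1 F) -[n in (_ && (n <= _))%N](mxrank1 F) -PQ -QP.
by rewrite (leq_trans (mxrankM_maxl _ _)) ?rank_leq_col // mulmx_max_rank.
Qed.

Lemma hsim_sq n (A B : 'M_n) : hsim A B ->
  exists2 W, W \in unitmx & A *m W = W *m B.
Proof. by move=> [P [Q [/mulmx1_unit[Pu _] _ AP]]]; exists P. Qed.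

Lemma hsim_rank m n (A : 'M_m) (B : 'M_n) : hsim A B -> \rank A = \rank B.
Proof.
suff le m' n' (A' : 'M_m') (B' : 'M_n') : hsim A' B' -> (\rank A' <= \rank B')%N.
  by move=> AB; apply/eqP; rewrite eqn_leq !le //; apply: hsim_sym.
move=> [P [Q [PQ QP AP]]]; rewrite -[A']mulmx1 -PQ mulmxA AP.
by apply: leq_trans (mxrankM_maxl _ _) (mxrankM_maxr _ _).
Qed.

Lemma hsim_exp m n (A : 'M_m) (B : 'M_n) k :
  hsim A B -> hsim (A ^+ k) (B ^+ k).
Proof.
move=> [P [Q [PQ QP AP]]]; exists P, Q; split=> //.
elim: k => [|k IH]; first by rewrite !expr0 mulmx1 mul1mx.
by rewrite !exprSr -!mulmxE -mulmxA AP mulmxA IH -mulmxA.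
Qed.

Lemma hsim_sub_scalar m n (A : 'M_m) (B : 'M_n) a :
  hsim A B -> hsim (A - a%:M) (B - a%:M).
Proof.
move=> [P [Q [PQ QP AP]]]; exists P, Q; split=> //.
by rewrite mulmxBl mulmxBr AP mul_scalar_mx mul_mx_scalar.
Qed.

Lemma hsim_det m n (A : 'M_m) (B : 'M_n) : hsim A B -> \det A = \det B.
Proof.
move=> AB; have e := hsim_size AB; case: n / e B AB => B /hsim_sq[W Wu AW].
have := congr1 determinant AW; rewrite !det_mulmx mulrC; apply: mulfI.
by rewrite -unitfE -unitmxE.
Qed.

Lemma hsim_block m1 m2 n1 n2 (A : 'M_m1) (B : 'M_m2) (A' : 'M_n1) (B' : 'M_n2) :
  hsim A A' -> hsim B B' -> hsim (block_mx A 0 0 B) (block_mx A' 0 0 B').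
Proof.
move=> [P [Q [PQ QP AP]]] [P' [Q' [PQ' QP' BP]]].
exists (block_mx P 0 0 P'), (block_mx Q 0 0 Q'); rewrite !mulmx_block.
by rewrite !(mul0mx, mulmx0, addr0, add0r) PQ QP PQ' QP' AP BP -!scalar_mx_block.
Qed.

Lemma hsim_swap m n (A : 'M_m) (B : 'M_n) :
  hsim (block_mx A 0 0 B) (block_mx B 0 0 A).
Proof.
exists (block_mx 0 1%:M 1%:M 0), (block_mx 0 1%:M 1%:M 0); rewrite !mulmx_block.
by rewrite !(mul0mx, mulmx0, addr0, add0r, mul1mx, mulmx1) -!scalar_mx_block.
Qed.

Lemma hsim_blockA m n p (A : 'M_m) (B : 'M_n) (D : 'M_p) :
  hsim (block_mx A 0 0 (block_mx B 0 0 D)) (block_mx (block_mx A 0 0 B) 0 0 D).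
Proof.
have := @block_mxAx _ m n p m n p A 0 0 0 B 0 0 0 D.
rewrite /= !(row_mx0, col_mx0) => ->; exact: hsim_castl (hsim_refl _).
Qed.

Lemma hsim_block_swap3 m n p (A : 'M_m) (B : 'M_n) (D : 'M_p) :
  hsim (block_mx A 0 0 (block_mx B 0 0 D)) (block_mx B 0 0 (block_mx A 0 0 D)).
Proof.
apply: hsim_trans (hsim_blockA _ _ _) _.
apply: hsim_trans (hsim_sym (hsim_blockA _ _ _)).
exact: hsim_block (hsim_swap _ _) (hsim_refl _).
Qed.

End HSim.

Section BlockDiagonal.
Variable F : fieldType.
Implicit Types (s : seq (F * nat)) (b : F * nat).

(** Block-diagonal matrices by recursion on the list of blocks, to allow proofs by
    induction on that list. *)
Fixpoint jdim s : nat := if s is b :: s' then b.2 + jdim s' else 0.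

Fixpoint bdiag (X : forall b, 'M[F]_(b.2)) s : 'M[F]_(jdim s) :=
  if s is b :: s' then block_mx (X b) 0 0 (bdiag X s') else 0.

Definition jblock b : 'M[F]_(b.2) := jordan_block b.1 b.2.
(** On each block, g applied to the diagonal part of the Jordan block. *)
Definition sblock (g : F -> F) b : 'M[F]_(b.2) := (g b.1)%:M.

Lemma jdimE s : jdim s = (\sum_(b <- s) b.2)%N.
Proof. by elim: s => [|b s IH] /=; rewrite ?big_nil // big_cons IH. Qed.

Lemma eq_bdiag (X Y : forall b, 'M[F]_(b.2)) s :
  (forall b, b \in s -> X b = Y b) -> bdiag X s = bdiag Y s.
Proof.
elim: s => //= b s IH XY; rewrite XY ?mem_head // IH // => c cs.
by rewrite XY // inE cs orbT.
Qed.

Lemma bdiagD X Y s : bdiag (fun b => X b + Y b) s = bdiag X s + bdiag Y s.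
Proof. by elim: s => [|b s IH] /=; rewrite ?addr0 // IH add_block_mx !addr0. Qed.

Lemma bdiagZ a X s : bdiag (fun b => a *: X b) s = a *: bdiag X s.
Proof. by elim: s => [|b s IH] /=; rewrite ?scaler0 // IH scale_block_mx !scaler0. Qed.

Lemma bdiagM X Y s : bdiag (fun b => X b *m Y b) s = bdiag X s *m bdiag Y s.
Proof.
elim: s => [|b s IH] /=; first by rewrite mulmx0.
by rewrite IH mulmx_block !(mul0mx, mulmx0, addr0, add0r).
Qed.

Lemma bdiag_scalar a s : bdiag (fun b => a%:M) s = a%:M.
Proof.
elim: s => [|b s IH] /=; last by rewrite IH -scalar_mx_block.
by rewrite [RHS]flatmx0.
Qed.

Lemma bdiag_sum (I : Type) (r : seq I) (X : I -> forall b, 'M[F]_(b.2)) s :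
  \sum_(i <- r) bdiag (X i) s = bdiag (fun b => \sum_(i <- r) X i b) s.
Proof.
elim: r => [|i r IH].
  rewrite big_nil -(scale0r (bdiag (fun=> 0) s)) -bdiagZ.
  by apply: eq_bdiag => b _; rewrite big_nil scaler0.
rewrite big_cons IH -bdiagD; apply: eq_bdiag => b _; by rewrite big_cons.
Qed.

Lemma bdiagX X k s : bdiag X s ^+ k = bdiag (fun b => X b ^+ k) s.
Proof.
elim: k => [|k IH].
  by rewrite expr0 -[1]/(1%:M) -bdiag_scalar; apply: eq_bdiag.
by rewrite exprS IH -mulmxE -bdiagM; apply: eq_bdiag => b _; rewrite exprS.
Qed.

Lemma rank_bdiag X s : \rank (bdiag X s) = (\sum_(b <- s) \rank (X b))%N.
Proof.
elim: s => [|b s IH] /=; first by rewrite big_nil mxrank0.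
by rewrite rank_diag_block_mx IH big_cons.
Qed.

Lemma det_bdiag X s : \det (bdiag X s) = \prod_(b <- s) \det (X b).
Proof.
elim: s => [|b s IH] /=; first by rewrite big_nil det_mx00.
by rewrite det_ublock IH big_cons.
Qed.

Lemma tr_bdiag X s : \tr (bdiag X s) = \sum_(b <- s) \tr (X b).
Proof.
elim: s => [|b s IH] /=; first by rewrite big_nil mxtrace0.
by rewrite mxtrace_block IH big_cons.
Qed.

(** The order of the blocks does not matter: by induction on the first list, its
    head is moved to the front of the second one by exchanging adjacent
    blocks. *)
Lemma hsim_bdiag_perm X s t : perm_eq s t -> hsim (bdiag X s) (bdiag X t).
Proof.
elim: s t => [|b s IH] t.
  by rewrite perm_sym => /perm_nilP ->; apply: hsim_refl.
move=> bst; have : b \in t by rewrite -(perm_mem bst) mem_head.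
move: bst => /[swap] /splitPr[t1 t2]; rewrite perm_sym.
rewrite -cat1s perm_catCA perm_cons perm_sym => /IH st.
apply: (@hsim_trans _ _ _ _ (bdiag X (b :: t1 ++ t2))).
  exact: hsim_block (hsim_refl _) st.
elim: t1 {st} => [|c t1 IH1] /=; first exact: hsim_refl.
apply: hsim_trans (hsim_block_swap3 _ _ _) _.
exact: hsim_block (hsim_refl _) IH1.
Qed.

Lemma hsim_jordan_mx s : hsim (jordan_mx s) (bdiag jblock s).
Proof.
elim: s => [|b s IH].
  exists 0, 0; split; rewrite ?mulmx0 ?mul0mx //.
    by apply/matrixP => i; exfalso; move: i; rewrite big_ord0 => -[].
  by rewrite [RHS]flatmx0.
rewrite /jordan_mx mxdiag_recl; apply: hsim_castl.
exact: hsim_block (hsim_refl _) IH.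
Qed.

Lemma jblock_scalar b a : jblock b + a%:M = jordan_block (b.1 + a) b.2.
Proof. by apply/matrixP => i j; rewrite !mxE mulrnDl addrAC. Qed.

Lemma hsim_jordan_shift (g : F -> F) s :
  hsim (bdiag jblock [seq (g b.1, b.2) | b <- s])
       (bdiag (fun b => jblock b + (g b.1 - b.1)%:M) s).
Proof.
elim: s => [|b s IH] /=; first exact: hsim_refl.
by apply: hsim_block IH; rewrite jblock_scalar addrC subrK; apply: hsim_refl.
Qed.

(** * Nullities of a Jordan matrix *)
Lemma jordan_block0X p k :
  (jordan_block 0 p : 'M[F]_p) ^+ k = \matrix_(i, j) ((i + k)%N == j :> nat)%:R.
Proof.
elim: k => [|k IH]; apply/matrixP => i j.
  by rewrite expr0 !mxE addn0 -val_eqE.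
rewrite exprS -mulmxE IH !mxE; under eq_bigr do rewrite !mxE mul0rn add0r.
have [lt_p|ge_p] := ltnP i.+1 p.
  rewrite (bigD1 (Ordinal lt_p)) //= eqxx mul1r big1 ?addr0 ?addSnnS // => l.
  by rewrite -val_eqE /= eq_sym => /negPf ->; rewrite mul0r.
rewrite big1 => [|l _]; last by rewrite (gtn_eqF (leq_trans _ ge_p)) ?mul0r.
by rewrite gtn_eqF // (leq_trans (ltn_ord j)) // (leq_trans ge_p) // -addSnnS leq_addr.
Qed.

(** Upper bound: only the first p - k rows of N^k are nonzero.  Lower bound:
    N^k times its transpose is the identity on those rows. *)
Lemma rank_jordan_block0X p k : \rank ((jordan_block 0 p : 'M[F]_p) ^+ k) = (p - k)%N.
Proof.
rewrite jordan_block0X; set N := \matrix_(i, j) _; apply/eqP; rewrite eqn_leq.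
apply/andP; split.
  have -> : N = pid_mx (p - k) *m N.
    apply/matrixP => i j; rewrite [RHS]mxE (bigD1 i) //= big1 => [|l].
      rewrite !mxE eqxx /= addr0; have [|ge_p] := ltnP i (p - k); rewrite ?mul1r //.
      by rewrite mul0r gtn_eqF //; have := ltn_ord j; lia.
    by rewrite eq_sym -val_eqE !mxE => /negPf ->; rewrite mul0r.
  by rewrite (leq_trans (mxrankM_maxl _ _)) // rank_pid_mx // leq_subr.
have NN : N *m N^T = pid_mx (p - k).
  apply/matrixP => i j; rewrite !mxE.
  have [lt_p|ge_p] := ltnP (i + k)%N p.
    rewrite (bigD1 (Ordinal lt_p)) //= !mxE eqxx mul1r big1 ?addr0 => [|l].
      by rewrite /= eqn_add2r ltn_subRL addnC lt_p andbT eq_sym.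
    by rewrite -val_eqE /= !mxE eq_sym => /negPf ->; rewrite mul0r.
  rewrite big1 => [|l _]; last by rewrite !mxE gtn_eqF ?mul0r // (leq_trans _ ge_p).
  by rewrite ltnNge leq_subLR addnC ge_p andbF.
by rewrite -(rank_pid_mx F (leq_subr k p) (leq_subr k p)) -NN mxrankM_maxl.
Qed.

Lemma jblockB b a : jblock b - a%:M = jordan_block (b.1 - a) b.2.
Proof. by rewrite -jblock_scalar raddfN. Qed.

Lemma det_jordan_block (a : F) p : \det (jordan_block a p) = a ^+ p.
Proof.
rewrite -det_tr det_trig.
  under eq_bigr => i _ do rewrite !mxE eqxx (gtn_eqF (ltnSn i)) addr0 mulr1n.
  by rewrite prodr_const card_ord.
apply/is_trig_mxP => i j ij; rewrite !mxE -val_eqE (gtn_eqF ij) mulr0n.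
by rewrite (gtn_eqF (ltnW _)) ?addr0.
Qed.

Lemma rank_jblockX b a k :
  \rank ((jblock b - a%:M) ^+ k) = (if b.1 == a then b.2 - k else b.2)%N.
Proof.
rewrite jblockB; case: eqP => [->|/eqP ba].
  by rewrite subrr rank_jordan_block0X.
apply: mxrank_unit; elim: k => [|k IH]; first by rewrite expr0 unitmx1.
rewrite exprS -mulmxE unitmx_mul IH andbT unitmxE det_jordan_block.
by rewrite unitfE expf_neq0 // subr_eq0.
Qed.

Lemma rank_jordan n (A : 'M[F]_n) s a k : hsim A (bdiag jblock s) ->
  \rank ((A - a%:M) ^+ k) = (\sum_(b <- s) (if b.1 == a then b.2 - k else b.2))%N.
Proof.
move=> /(hsim_sub_scalar a) /(hsim_exp k) /hsim_rank ->.
rewrite -bdiag_scalar -scaleN1r -bdiagZ -bdiagD bdiagX rank_bdiag.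
by apply: eq_bigr => b _; rewrite scaleN1r rank_jblockX.
Qed.

(** These dimensions determine the Jordan blocks and are what survives a
    perturbation. *)
Lemma nullity_jordan n (A : 'M[F]_n) s a k : hsim A (bdiag jblock s) ->
  (n - \rank ((A - a%:M) ^+ k) = \sum_(b <- s | b.1 == a) minn b.2 k)%N.
Proof.
move=> As; rewrite (rank_jordan _ _ As) (hsim_size As) jdimE [RHS]big_mkcond.
elim: s {As} => [|b s IH]; rewrite ?big_nil // !big_cons -IH.
have : (\sum_(j <- s) (if j.1 == a then j.2 - k else j.2) <= \sum_(j <- s) j.2)%N.
  by apply: leq_sum => j _; case: ifP => _; rewrite ?leq_subr.
by case: ifP => _ /=; lia.
Qed.

Lemma det_jordan n (A : 'M[F]_n) s a : hsim A (bdiag jblock s) ->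
  \det (A - a%:M) = \prod_(b <- s) (b.1 - a) ^+ b.2.
Proof.
move=> /(hsim_sub_scalar a) /hsim_det ->.
rewrite -bdiag_scalar -scaleN1r -bdiagZ -bdiagD det_bdiag.
by apply: eq_bigr => b _; rewrite scaleN1r jblockB det_jordan_block.
Qed.

Lemma eigenvalue_jordan n (A : 'M[F]_n) s a : hsim A (bdiag jblock s) ->
  all (fun b => 0 < b.2)%N s ->
  eigenvalue A a = (a \in [seq b.1 | b <- s]).
Proof.
move=> As s_gt0; rewrite /eigenvalue /eigenspace -mxrank_eq0 mxrank_ker.
rewrite -[A - _]expr1 (nullity_jordan _ _ As).
elim: s s_gt0 {As} => [|b s IH] /=; first by rewrite big_nil.
move=> /andP[b_gt0 /IH {}IH]; rewrite big_cons inE [a == _]eq_sym.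
case: (b.1 =P a) => /= _; last by rewrite IH.
by rewrite addn_eq0; lia.
Qed.

End BlockDiagonal.

Section PolyEval.
Variable F : fieldType.

(** * Spectral idempotents as polynomials in the matrix *)

(** Evaluation of a polynomial at a square matrix of arbitrary size, since
    [horner_mx] is only defined for matrices of positive size. *)
Definition peval n : 'M[F]_n -> {poly F} -> 'M_n :=
  if n is n'.+1 then fun A p => horner_mx A p else fun A _ => A.

Lemma pevalC n (A : 'M_n) c : peval A c%:P = c%:M.
Proof. by case: n A => [|n] A /=; rewrite ?horner_mx_C // [RHS]flatmx0 [LHS]flatmx0. Qed.

Lemma pevalX n (A : 'M_n) : peval A 'X = A.
Proof. by case: n A => [|n] A //=; rewrite horner_mx_X. Qed.

Lemma pevalD n (A : 'M_n) p q : peval A (p + q) = peval A p + peval A q.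
Proof. by case: n A => [|n] A /=; rewrite ?rmorphD // [RHS]flatmx0 [LHS]flatmx0. Qed.

Lemma pevalB n (A : 'M_n) p q : peval A (p - q) = peval A p - peval A q.
Proof. by case: n A => [|n] A /=; rewrite ?rmorphB // [RHS]flatmx0 [LHS]flatmx0. Qed.

Lemma pevalM n (A : 'M_n) p q : peval A (p * q) = peval A p *m peval A q.
Proof. by case: n A => [|n] A /=; rewrite ?rmorphM // [RHS]flatmx0 [LHS]flatmx0. Qed.

Lemma peval_XsubC_exp n (A : 'M_n) c k :
  peval A (('X - c%:P) ^+ k) = (A - c%:M) ^+ k.
Proof.
elim: k => [|k IH]; first by rewrite !expr0 -[1]/(1%:P) pevalC.
by rewrite !exprS pevalM IH pevalB pevalX pevalC.
Qed.

Lemma peval_intertwine m n (A : 'M_m) (B : 'M_n) (P : 'M_(m, n)) p :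
  A *m P = P *m B -> peval A p *m P = P *m peval B p.
Proof.
move=> AP; elim/poly_ind: p => [|p c IH].
  by rewrite -[0]/(0%:P) !pevalC mul_scalar_mx mul_mx_scalar.
rewrite !pevalD !pevalM !pevalX !pevalC mulmxDl mulmxDr.
by rewrite -mulmxA AP mulmxA IH mulmxA mul_scalar_mx mul_mx_scalar.
Qed.

Lemma peval_trmx n (T : 'M_n) p : (peval T p)^T = peval T^T p.
Proof.
elim/poly_ind: p => [|p c IH]; first by rewrite -[0]/(0%:P) !pevalC tr_scalar_mx.
rewrite !pevalD !pevalM !pevalX !pevalC linearD /= tr_scalar_mx trmx_mul IH.
by rewrite (peval_intertwine p (erefl (T^T *m T^T))).
Qed.

Lemma peval_trig n (T : 'M_n) p : is_trig_mx T -> is_trig_mx (peval T p).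
Proof.
move=> Tt; elim/poly_ind: p => [|p c IH].
  by rewrite -[0]/(0%:P) pevalC scalar_mx_is_trig.
rewrite pevalD pevalM pevalX pevalC; have /is_trig_mxP pTt := trig_mx_mul IH Tt.
apply/is_trig_mxP => i j ij; rewrite mxE pTt // add0r.
by rewrite (is_trig_mxP (scalar_mx_is_trig _ c)).
Qed.

Lemma peval_bdiag X (s : seq (F * nat)) p :
  peval (bdiag X s) p = bdiag (fun b => peval (X b) p) s.
Proof.
elim/poly_ind: p => [|p c IH].
  rewrite -[0]/(0%:P) pevalC -bdiag_scalar.
  by apply: eq_bdiag => b _; rewrite pevalC.
rewrite pevalD pevalM pevalX pevalC IH -bdiagM -bdiag_scalar -bdiagD.
by apply: eq_bdiag => b _; rewrite pevalD pevalM pevalX pevalC.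
Qed.

(** By Bezout, u (X - a)^K + v q = 1, where q collects the other eigenvalues and
    K is at least every block size.  Then v q is 1 on the blocks of a, where
    (X - a)^K vanishes, and 0 on all others, where q vanishes. *)
Lemma jordan_spectral_poly (s : seq (F * nat)) a : exists p : {poly F},
  forall b, b \in s -> peval (jblock b) p = sblock (fun x => (x == a)%:R) b.
Proof.
pose K := (\sum_(b <- s) b.2)%N.
pose q : {poly F} := \prod_(b <- s | b.1 != a) ('X - b.1%:P) ^+ K.
have nil b : b \in s -> (jblock b - b.1%:M) ^+ K = 0.
  move=> bs; rewrite jblockB subrr jordan_block0X.
  apply/matrixP => i j; rewrite !mxE gtn_eqF // (leq_trans (ltn_ord j)) //.
  by rewrite (leq_trans _ (leq_addl _ _)) // /K (big_rem b) //= leq_addr.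
have /Bezout_eq1_coprimepP[[u v] /= uv] : coprimep (('X - a%:P) ^+ K) q.
  apply: (big_ind (coprimep _)) => [|x y cx cy|b ba]; first exact: coprimep1.
    by rewrite coprimepMr cx.
  by apply/coprimep_expl/coprimep_expr/coprimep_XsubC2; rewrite subr_eq0.
exists (v * q) => b bs; rewrite /sblock; case: eqP => [ba|/eqP ba] /=.
  rewrite -[v * q](addKr (u * ('X - a%:P) ^+ K)) uv pevalD -[1]/(1%:P) pevalC.
  rewrite -mulNr pevalM peval_XsubC_exp -ba nil //.
  by rewrite mulmx0 add0r.
rewrite pevalM /q (big_rem b) //= ba pevalM peval_XsubC_exp nil //.
by rewrite mul0mx mulmx0 raddf0.
Qed.

(** Adding (f x - x) times the idempotent of x shifts the eigenvalue x to f x and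
    leaves the sizes of the blocks unchanged. *)
Lemma spectral_family n (A : 'M[F]_n) (s : seq (F * nat)) :
  hsim A (bdiag (@jblock F) s) -> all (fun b => 0 < b.2)%N s ->
  let L := undup [seq b.1 | b <- s] in
  exists e : F -> {poly F},
  [/\ forall x y, peval A (e x) *m peval A (e y) =
        if x == y then peval A (e x) else 0,
      forall x, x \in L -> exists2 k, (0 < k)%N & \tr (peval A (e x)) = k%:R &
      forall f : F -> F, hsim (A + \sum_(x <- L) (f x - x) *: peval A (e x))
        (bdiag (@jblock F) [seq (f b.1, b.2) | b <- s])].
Proof.
move=> [P [Q [PQ QP AP]]] s_gt0 L; have [e eP] := choice (jordan_spectral_poly s).
pose S x := bdiag (sblock (fun y => (y == x)%:R)) s.
have PS x : peval A (e x) *m P = P *m S x.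
  rewrite (peval_intertwine _ AP) peval_bdiag; congr (_ *m _).
  by apply: eq_bdiag => b /eP.
have PSQ x : peval A (e x) = P *m S x *m Q by rewrite -PS -mulmxA PQ mulmx1.
have SS x y : S x *m S y = if x == y then S x else 0.
  rewrite /S -bdiagM; case: eqVneq => [<-|xy].
    by apply: eq_bdiag => b _; rewrite -scalar_mxM -natrM mulnb andbb.
  transitivity ((0 : F)%:M : 'M_(jdim s)); last by rewrite raddf0.
  rewrite -bdiag_scalar; apply: eq_bdiag => b _.
  rewrite -scalar_mxM -natrM mulnb; case: (b.1 =P x) => //= ->.
  by rewrite (negPf xy).
exists e; split=> [x y|x|f].
- rewrite !PSQ -!mulmxA (mulmxA Q) QP mul1mx (mulmxA (S x)) SS.
  by case: eqP => // _; rewrite mul0mx mulmx0.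
- rewrite mem_undup => /mapP[b bs xb].
  exists (\sum_(c <- s | c.1 == x) c.2)%N.
    rewrite (big_rem b) //= xb eqxx addn_gt0; have /allP -> // := s_gt0.
  rewrite PSQ mxtrace_mulC mulmxA QP mul1mx tr_bdiag natr_sum [RHS]big_mkcond.
  by apply: eq_bigr => c _; rewrite mxtrace_scalar; case: eqP; rewrite ?mul0rn.
apply: (@hsim_trans _ _ _ _ _ _ _ _ (hsim_sym (hsim_jordan_shift f s))).
exists P, Q; split=> //; rewrite mulmxDl AP mulmx_suml.
have -> : \sum_(x <- L) (f x - x) *: peval A (e x) *m P =
          P *m \sum_(x <- L) (f x - x) *: S x.
  by rewrite mulmx_sumr; apply: eq_bigr => x _; rewrite -scalemxAl PS scalemxAr.
rewrite -mulmxDr; congr (_ *m _); rewrite bdiagD; congr (_ + _).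
under eq_bigr do rewrite -bdiagZ; rewrite bdiag_sum; apply: eq_bdiag => b bs.
rewrite (bigD1_seq b.1) ?undup_uniq ?mem_undup ?map_f //= big1 => [|x xb].
  by rewrite /sblock eqxx addr0 scale_scalar_mx mulr1.
by rewrite /sblock eq_sym (negPf xb) scale_scalar_mx mulr0 raddf0.
Qed.

End PolyEval.

Section BlockCount.

(** * The Jordan structure in terms of nullities *)

(** The second difference of k |-> min(x, k) is supported at k = x, so the sums of
    min(x, k) over a list count how often each positive value occurs. *)
Lemma count_minn (t : seq nat) k :
  (count_mem k.+1 t + \sum_(x <- t) minn x k + \sum_(x <- t) minn x k.+2
   = (\sum_(x <- t) minn x k.+1).*2)%N.
Proof.
elim: t => [|x t IH]; rewrite ?big_nil // !big_cons /=.
by move: IH; rewrite -!addnn; case: (x =P k.+1) => xk /=; lia.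
Qed.

Lemma count_pair (T : eqType) (s : seq (T * nat)) a k :
  count_mem (a, k) s = count_mem k [seq b.2 | b <- s & b.1 == a].
Proof.
elim: s => //= -[x y] s IH; rewrite xpair_eqE IH.
by case: (x == a).
Qed.

Lemma big_fibre (T : eqType) (L : seq T) (s : seq (T * nat)) (w : nat -> nat) :
  uniq L -> {subset [seq b.1 | b <- s] <= L} ->
  (\sum_(b <- s) w b.2 = \sum_(a <- L) \sum_(b <- s | b.1 == a) w b.2)%N.
Proof.
move=> uL sL; rewrite (exchange_big_dep xpredT) //=.
rewrite big_seq [RHS]big_seq; apply: eq_bigr => b bs.
rewrite [RHS]big_mkcond (bigD1_seq b.1) ?sL ?map_f //= eqxx big1 ?addn0 // => a.
by rewrite eq_sym => /negPf ->.
Qed.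

(** A Jordan form is determined, up to the order of its blocks, by its nullities;
    positivity of the sizes is needed because blocks of size 0 are invisible to
    them. *)
Lemma perm_of_minn (T : eqType) (s t : seq (T * nat)) (L : seq T) :
  all (fun b => 0 < b.2)%N s -> all (fun b => 0 < b.2)%N t ->
  {subset [seq b.1 | b <- s] <= L} -> {subset [seq b.1 | b <- t] <= L} ->
  (forall a k, a \in L -> \sum_(b <- s | b.1 == a) minn b.2 k =
                          \sum_(b <- t | b.1 == a) minn b.2 k)%N ->
  perm_eq s t.
Proof.
move=> s_gt0 t_gt0 sL tL st; apply/allP => -[a k] _ /=; apply/eqP.
have pos r : all (fun b : T * nat => 0 < b.2)%N r -> count_mem (a, 0%N) r = 0%N.
  by move=> /allP r0; apply/count_memPn/negP => /r0.
case: k => [|k]; first by rewrite !pos.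
have [aL|aL] := boolP (a \in L); last first.
  have notin r : {subset [seq b.1 | b <- r] <= L} -> count_mem (a, k.+1) r = 0%N.
    by move=> rL; apply/count_memPn/negP => /(map_f fst)/rL; apply/negP.
  by rewrite !notin.
rewrite !count_pair; set u := [seq _ | b <- s & _]; set v := [seq _ | b <- t & _].
have uv j : (\sum_(x <- u) minn x j = \sum_(x <- v) minn x j)%N.
  by rewrite !big_map !big_filter st.
by have := count_minn u k; have := count_minn v k; rewrite !uv; lia.
Qed.

End BlockCount.

Section JordanStructureData.
Variable F : fieldType.
Implicit Types s : seq (F * nat).

Lemma eigenvalues_jordan n (A : 'M[F]_n) s : hsim A (bdiag (@jblock F) s) ->
  all (fun b => 0 < b.2)%N s -> undup [seq b.1 | b <- s] =i eigenvalue A.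
Proof. by move=> As s_gt0 a; rewrite mem_undup -(eigenvalue_jordan _ As s_gt0). Qed.

(** The total depends on A alone, not on the list of blocks chosen for it. *)
Lemma sum_minn_nullity n (A : 'M[F]_n) s (L : seq F) k :
  hsim A (bdiag (@jblock F) s) -> all (fun b => 0 < b.2)%N s ->
  uniq L -> L =i eigenvalue A ->
  (\sum_(b <- s) minn b.2 k = \sum_(a <- L) (n - \rank ((A - a%:M) ^+ k)))%N.
Proof.
move=> As s_gt0 uL LA; rewrite (@big_fibre _ L s (fun p => minn p k)) //.
  by apply: eq_bigr => a _; rewrite (nullity_jordan _ _ As).
by move=> a; rewrite LA -mem_undup (eigenvalues_jordan As).
Qed.

(** Padding with zeros up to length n does not change the sum. *)
Lemma sum_block_sizes n s a k : (size s <= n)%N ->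
  (\sum_(p <- block_sizes n s a) minn p k = \sum_(b <- s | b.1 == a) minn b.2 k)%N.
Proof.
move=> sn; rewrite /block_sizes; set t := sort _ _.
have tn : (size t <= n)%N.
  rewrite size_sort size_map size_filter; exact: leq_trans (count_size _ _) sn.
rewrite big_map; have -> : iota 0 n = index_iota 0 n by rewrite /index_iota subn0.
rewrite (big_cat_nat (n := size t)) //= -(big_nth 0%N xpredT (fun p => minn p k)).
have -> : (\sum_(size t <= i < n) minn (nth 0 t i) k = 0)%N.
  rewrite big_nat_cond big1 // => i; rewrite andbT => /andP[ti _].
  by rewrite nth_default ?min0n.
by rewrite addn0 (perm_big _ (permEl (perm_sort _ _))) big_map big_filter.
Qed.

(** The consequences of the Jordan structure that the perturbation argument uses:
    the number of eigenvalues and, for each k, the total nullity of the k-th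
    powers, both of which can be read off from Om. *)
Lemma jordan_structureP n (A : 'M[F]_n) Om : jordan_structure A Om ->
  exists s, [/\ hsim A (bdiag (@jblock F) s), all (fun b => 0 < b.2)%N s,
    size (undup [seq b.1 | b <- s]) = size Om &
    forall k, (\sum_(b <- s) minn b.2 k = \sum_(t <- Om) \sum_(p <- t) minn p k)%N].
Proof.
move=> [s [L [[s_gt0 [e [P [Pu AP]]]] uL LA OmE]]]; exists s.
have As : hsim A (bdiag (@jblock F) s).
  apply: hsim_trans (hsim_unit Pu AP) _; apply: hsim_castl.
  exact: hsim_jordan_mx.
have sL : perm_eq (undup [seq b.1 | b <- s]) L.
  apply: uniq_perm; rewrite ?undup_uniq // => a.
  by rewrite LA (eigenvalues_jordan As).
have sn : (size s <= n)%N.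
  rewrite (hsim_size As) jdimE -sum1_size big_seq [X in (_ <= X)%N]big_seq.
  by apply: leq_sum => b /(allP s_gt0).
split=> // [|k]; first by rewrite (perm_size sL) (perm_size OmE) size_map.
rewrite (perm_big _ OmE) big_map (@big_fibre _ L s (fun p => minn p k)) //.
  by apply: eq_bigr => a _; rewrite sum_block_sizes.
by move=> a; rewrite -mem_undup (perm_mem sL).
Qed.

End JordanStructureData.

Section Nearness.
Variable R : realType.
Local Notation C := R[i].

(** * Nearby eigenvalues and ranks *)
Lemma uniform_radius (T : eqType) (r : seq T) (P : T -> R -> Prop) :
  (forall x d d', d' <= d -> P x d -> P x d') ->
  (forall x, x \in r -> exists2 d, 0 < d & P x d) ->
  exists2 d, 0 < d & forall x, x \in r -> P x d.
Proof.
move=> Pmono; elim: r => [|x r IH] Pr; first by exists 1.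
have [d d0 Pd] := Pr x (mem_head _ _).
have [y yr|d' d'0 Pd'] := IH; first by apply: Pr; rewrite inE yr orbT.
exists (Num.min d d') => [|y]; first by rewrite lt_min d0.
rewrite inE => /orP[/eqP ->|/Pd'].
  by apply: Pmono Pd; rewrite ge_min lexx.
by apply: Pmono; rewrite ge_min lexx orbT.
Qed.

Lemma normc_prodB (I : eqType) (r : seq I) (a b : I -> C) (M d : R) :
  1 <= M -> (forall i, normc (a i) <= M) -> (forall i, normc (b i) <= M) ->
  (forall i, normc (a i - b i) <= d) ->
  normc (\prod_(i <- r) a i - \prod_(i <- r) b i) <= (size r)%:R * M ^+ size r * d.
Proof.
move=> M1 aM bM abd; have M0 : 0 <= M by apply: le_trans M1.
elim: r => [|i r IH]; first by rewrite !big_nil subrr normc0 !mul0r.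
have d0 : 0 <= d by apply: le_trans (abd i); apply: normc_ge0.
rewrite !big_cons; set p := \prod_(j <- r) a j; set q := \prod_(j <- r) b j.
have -> : a i * p - b i * q = a i * (p - q) + (a i - b i) * q by ring.
have qM : normc q <= M ^+ size r.
  rewrite normc_prod /q; elim: r {IH p q} => [|j r IHr]; first by rewrite big_nil.
  by rewrite big_cons exprS ler_pM ?normc_ge0 // prodr_ge0 // => *; apply: normc_ge0.
apply: le_trans (normcD _ _) _; rewrite !normcM /=.
have h1 : normc (a i) * normc (p - q) <= M * ((size r)%:R * M ^+ size r * d).
  by rewrite ler_pM ?normc_ge0.
have h2 : normc (a i - b i) * normc q <= d * M ^+ size r by rewrite ler_pM ?normc_ge0.
(* The factor |b| <= M^(size r) is weakened to match the exponent of the claim. *)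
have h3 : d * M ^+ size r <= d * M ^+ (size r).+1.
  by rewrite ler_wpM2l // exprS ler_peMl ?exprn_ge0.
apply: le_trans (lerD h1 (le_trans h2 h3)) _.
by rewrite -natr1 exprS le_eqVlt; apply/orP; left; apply/eqP; ring.
Qed.

Lemma det_lipschitz n (B0 : 'M[C]_n) : exists2 K : R, 0 < K &
  forall B, l1norm (B - B0) <= 1 -> normc (\det B - \det B0) <= K * l1norm (B - B0).
Proof.
pose M := l1norm B0 + 1; have M1 : 1 <= M by rewrite lerDr l1norm_ge0.
pose c := n%:R * M ^+ n.
have c_ge : 0 <= c by rewrite mulr_ge0 // exprn_ge0 // (le_trans _ M1).
exists (\sum_(s : 'S_n) c + 1) => [|B B1]; first by rewrite ltr_wpDl // sumr_ge0.
rewrite /determinant -sumrB; apply: le_trans (normc_sum _ _ _) _.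
apply: (@le_trans _ _ (\sum_(s : {perm 'I_n}) c * l1norm (B - B0))).
  apply: ler_sum => s _; rewrite -mulrBr normcM normcX normc_opp normc1 expr1n mul1r.
  have -> : c = (size (index_enum 'I_n))%:R * M ^+ size (index_enum 'I_n).
    by rewrite /index_enum unlock /= -enumT size_enum_ord.
  apply: normc_prodB => [//|i|i|i].
  - rewrite -[B](subrK B0) addrC mxE; apply: le_trans (normcD _ _) _.
    by rewrite lerD ?l1norm_entry // (le_trans (l1norm_entry _ _ _)).
  - by rewrite (le_trans (l1norm_entry _ _ _)) // lerDl.
  - by have := l1norm_entry (B - B0) i (s i); rewrite !mxE.
by rewrite -mulr_suml ler_wpM2r ?l1norm_ge0 // lerDl.
Qed.

(** The determinant of A - lam is small and is the product of the distances from
    lam to the n eigenvalues of A, so one of these is small. *)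
Lemma eigenvalue_near n (A0 : 'M[C]_n) lam (eta : R) :
  eigenvalue A0 lam -> 0 < eta ->
  exists2 d : R, 0 < d & forall A s, l1norm (A - A0) <= d ->
    hsim A (bdiag (@jblock _) s) ->
    exists2 b, b \in s & normc (b.1 - lam) <= eta.
Proof.
move=> A0lam eta0; have [K K0 detK] := det_lipschitz (A0 - lam%:M).
have en0 : 0 < eta ^+ n by rewrite exprn_gt0.
exists (Num.min 1 (eta ^+ n / (K + 1))) => [|A s].
  by rewrite lt_min ltr01 divr_gt0 // addr_gt0.
rewrite le_min => /andP[A1 Ad] As; apply/hasP; apply/negPn/negP => /hasPn far.
have BB : A - lam%:M - (A0 - lam%:M) = A - A0 by rewrite opprB addrA subrK.
have det0 : \det (A0 - lam%:M) = 0.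
  apply/eqP; apply: contraTT A0lam => detu; rewrite /eigenvalue /eigenspace negbK.
  by rewrite kermx_eq0 row_free_unit unitmxE unitfE.
have := detK (A - lam%:M); rewrite BB det0 subr0 (det_jordan _ As) => /(_ A1).
rewrite normc_prod => small.
have big : eta ^+ n <= \prod_(b <- s) normc ((b.1 - lam) ^+ b.2).
  rewrite (hsim_size As) jdimE -prodrXr big_seq [leRHS]big_seq.
  apply: ler_prod => b bs; rewrite exprn_ge0 ?(ltW eta0) //= normcX.
  by rewrite lerXn2r ?nnegrE ?normc_ge0 ?(ltW eta0) // ltW // ltNge far.
have := le_trans big small; apply/negP; rewrite -ltNge.
rewrite ler_pdivlMr ?addr_gt0 // in Ad; have := l1norm_ge0 (A - A0).
rewrite le_eqVlt => /orP[/eqP <-|A_gt0]; first by rewrite mulr0.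
by apply: lt_le_trans Ad; rewrite mulrC ltr_pM2l // ltrDl.
Qed.

(** Rank is lower semicontinuous, and (A - mu)^k depends continuously on A and
    mu. *)
Lemma rank_near n (A0 : 'M[C]_n) lam k : exists2 d : R, 0 < d &
  forall A mu, l1norm (A - A0) <= d -> normc (mu - lam) <= d ->
  (\rank ((A0 - lam%:M) ^+ k) <= \rank ((A - mu%:M) ^+ k))%N.
Proof.
set B0 := A0 - lam%:M; set G := pinvmx (B0 ^+ k).
pose e := l1norm (1%:M : 'M[C]_n); have e0 : 0 <= e by apply: l1norm_ge0.
have G0 := l1norm_ge0 G; have B00 := l1norm_ge0 B0.
(* M bounds both B0 and A - mu, as d <= 1. *)
pose M := l1norm B0 + 1 + e; have M1 : 1 <= M by rewrite /M; lra.
pose c := k%:R * M ^+ k * (1 + e) * l1norm G.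
have c0 : 0 <= c.
  by rewrite !mulr_ge0 ?exprn_ge0 ?addr_ge0.
exists (Num.min 1 (c + 1)^-1) => [|A mu].
  by rewrite lt_min ltr01 invr_gt0 ltr_wpDl.
set d := Num.min _ _ => Ad mud.
have d1 : d <= 1 by rewrite ge_min lexx.
have d_gt : 0 < d by rewrite lt_min ltr01 invr_gt0 ltr_wpDl.
have d_ge := ltW d_gt.
have cd : c * d < 1.
  have : d <= (c + 1)^-1 by rewrite ge_min lexx orbT.
  rewrite -[_^-1]mul1r ler_pdivlMr ?ltr_wpDl //.
  by lra.
apply: rank_lsc; apply: le_lt_trans (l1normM _ _) _.
have BB : l1norm (A - mu%:M - B0) <= (1 + e) * d.
  have -> : A - mu%:M - B0 = (A - A0) - (mu - lam) *: 1%:M.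
    by rewrite scalerBl !scalemx1 /B0 !opprB addrACA [RHS]addrACA [- mu%:M - _]addrC.
  apply: le_trans (l1normB _ _) _; rewrite l1normZ mulrDl mul1r lerD //.
  by rewrite mulrC ler_wpM2l.
have BM : l1norm (A - mu%:M) <= M.
  rewrite -[A - _](subrK B0) addrC; apply: le_trans (l1normD _ _) _.
  have : e * d <= e by rewrite ler_piMr.
  by rewrite /M; lra.
have B0M : l1norm B0 <= M by rewrite /M; lra.
have M0 : 0 <= k%:R * M ^+ k by rewrite mulr_ge0 // exprn_ge0 // (le_trans _ M1).
apply: (le_lt_trans _ cd).
have -> : c * d = k%:R * M ^+ k * ((1 + e) * d) * l1norm G by rewrite /c; ring.
apply: ler_wpM2r => //; apply: le_trans (l1normXB k BM B0M M1) _.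
exact: ler_wpM2l.
Qed.

End Nearness.

Section Matching.
Variable R : realType.
Local Notation C := R[i].
Local Notation J := (bdiag (@jblock C)).
Local Notation eigs s := (undup [seq b.1 | b <- s]).
Implicit Types s : seq (C * nat).

(** * Matrices with the same Jordan structure are nearly conjugate *)
Lemma separation (L : seq C) : exists2 eta : R, 0 < eta &
  forall x y, x \in L -> y \in L -> x != y -> 2 * eta < normc (x - y).
Proof.
have [|[x y] _|d d0 dP] := @uniform_radius R _ [seq (x, y) | x <- L, y <- L]
  (fun xy d => xy.1 != xy.2 -> 2 * d < normc (xy.1 - xy.2)).
- by move=> xy d d' dd' P /P; apply: le_lt_trans; rewrite ler_pM2l.
- have [->|xy] := eqVneq x y; first by exists 1; rewrite //= eqxx.
  have n0 : 0 < normc (x - y) by rewrite lt_def normc_eq0 subr_eq0 xy normc_ge0.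
  by exists (normc (x - y) / 3) => [|_ /=]; lra.
- by exists d => // x y xL yL xy; apply: (dP (x, y)) => //; apply: allpairs_f.
Qed.

(** Distinct eigenvalues of A0 are too far apart to have a common neighbour, so
    choosing neighbours is injective; it is onto because the spectra have the
    same size. *)
Lemma eigenvalue_matching n (A0 : 'M[C]_n) s0 (eta : R) :
  hsim A0 (J s0) -> all (fun b => 0 < b.2)%N s0 -> 0 < eta ->
  exists2 d : R, 0 < d & forall A s, l1norm (A - A0) <= d ->
    hsim A (J s) -> size (eigs s) = size (eigs s0) ->
    exists f : C -> C, [/\ {in eigs s0, forall x, normc (f x - x) <= eta},
      {in eigs s0 &, injective f} & map f (eigs s0) =i eigs s].
Proof.
move=> As0 s0_gt0 eta0; set L := eigs s0.
(* Neighbours within the separation radius h determine the eigenvalue. *)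
have [h h0 sepL] := separation L; pose t := Num.min h eta.
have t0 : 0 < t by rewrite lt_min h0.
have [|x xL|d d0 dP] := @uniform_radius R _ L (fun x d => forall A s,
  l1norm (A - A0) <= d -> hsim A (J s) -> exists2 b, b \in s & normc (b.1 - x) <= t).
- by move=> x d d' dd' P A s Ad; apply: P; apply: le_trans dd'.
- by apply: eigenvalue_near => //; have := eigenvalues_jordan As0 s0_gt0 x; rewrite xL.
exists d => // A s Ad As sizeL.
have /choice[f fP] : forall x, exists y, x \in L -> y \in eigs s /\ normc (y - x) <= t.
  move=> x; have [xL|] := boolP (x \in L); last by exists 0.
  have [b bs bx] := dP x xL A s Ad As; exists b.1 => _; split=> //.
  by rewrite mem_undup map_f.
have fI : {in L &, injective f}.
  move=> x y xL yL fxy; apply/eqP; apply: contraT => xy.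
  have := sepL x y xL yL xy; have [_ fx] := fP x xL; have [_ fy] := fP y yL.
  have := normcD (f y - y) (- (f x - x)); rewrite normc_opp fxy.
  have -> : f y - y - (f y - x) = x - y by rewrite opprB addrC addrA subrK.
  have : t <= h by rewrite ge_min lexx.
  by rewrite fxy in fx; lra.
exists f; split=> // [x /fP[_] fx|].
  by apply: le_trans fx _; rewrite ge_min lexx orbT.
have uf : uniq (map f L) by rewrite map_inj_in_uniq ?undup_uniq.
have sub : {subset map f L <= eigs s} by move=> _ /mapP[x /fP[fxs _] ->].
by have [|_ //] := uniq_min_size uf sub; rewrite size_map sizeL.
Qed.

(** Each nullity of A is at most the corresponding one of A0, and their sums
    agree; so they are equal, and A has the Jordan blocks of A0 with every
    eigenvalue x replaced by f x. *)
Lemma similar_near n (A0 : 'M[C]_n) s0 (eta : R) :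
  hsim A0 (J s0) -> all (fun b => 0 < b.2)%N s0 -> 0 < eta ->
  exists2 d : R, 0 < d & forall A s, l1norm (A - A0) <= d ->
    hsim A (J s) -> all (fun b => 0 < b.2)%N s ->
    size (eigs s) = size (eigs s0) ->
    (forall k, \sum_(b <- s) minn b.2 k = \sum_(b <- s0) minn b.2 k)%N ->
    exists2 f : C -> C, {in eigs s0, forall x, normc (f x - x) <= eta} &
      hsim A (J [seq (f b.1, b.2) | b <- s0]).
Proof.
move=> As0 s0_gt0 eta0; set L := eigs s0.
pose ks := iota 0 n.+1.
have [|[x k] _|r r0 rP] := @uniform_radius R _ [seq (x, k) | x <- L, k <- ks]
  (fun xk d => forall A mu, l1norm (A - A0) <= d -> normc (mu - xk.1) <= d ->
  (\rank ((A0 - xk.1%:M) ^+ xk.2) <= \rank ((A - mu%:M) ^+ xk.2))%N).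
- by move=> xk d d' dd' P A mu Ad mud; apply: P; apply: le_trans dd'.
- exact: rank_near.
pose t := Num.min r eta; have t0 : 0 < t by rewrite lt_min r0.
have [d d0 dP] := eigenvalue_matching As0 s0_gt0 t0.
exists (Num.min d r) => [|A s]; first by rewrite lt_min d0.
rewrite le_min => /andP[Ad Ar] As s_gt0 sizeL sums.
have [f [fnear fI fL]] := dP A s Ad As sizeL.
exists f => [x xL|]; first by apply: le_trans (fnear x xL) _; rewrite ge_min lexx orbT.
apply: (hsim_trans As); apply: hsim_bdiag_perm.
have ufL : uniq (map f L) by rewrite map_inj_in_uniq ?undup_uniq.
have le_null x k : x \in L -> (k <= n)%N ->
    (\sum_(b <- s | b.1 == f x) minn b.2 k <= \sum_(b <- s0 | b.1 == x) minn b.2 k)%N.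
  move=> xL kn; rewrite -(nullity_jordan _ _ As) -(nullity_jordan _ _ As0).
  have kks : k \in ks by rewrite mem_iota ltnS.
  apply/leq_sub2l/(rP (x, k) (allpairs_f _ xL kks)) => //.
  by apply: le_trans (fnear x xL) _; rewrite ge_min lexx.
have eq_null x k : x \in L -> (k <= n)%N ->
    (\sum_(b <- s | b.1 == f x) minn b.2 k = \sum_(b <- s0 | b.1 == x) minn b.2 k)%N.
  move=> xL kn; apply/eqP; rewrite eqn_leq le_null //=.
  have := sums k; rewrite (@big_fibre _ (map f L) s (fun p => minn p k)) //; last first.
    by move=> y; rewrite fL mem_undup.
  rewrite (@big_fibre _ L s0 (fun p => minn p k)) ?undup_uniq //; last first.
    by move=> y; rewrite mem_undup.
  rewrite big_map !(big_rem x xL) /=.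
  have : (\sum_(y <- rem x L) \sum_(b <- s | b.1 == f y) minn b.2 k <=
          \sum_(y <- rem x L) \sum_(b <- s0 | b.1 == y) minn b.2 k)%N.
    rewrite big_seq [X in (_ <= X)%N]big_seq; apply: leq_sum => y yL.
    by apply: le_null kn; apply: mem_rem yL.
  move=> le_rem eq_sum.
  rewrite -(leq_add2r (\sum_(y <- rem x L) \sum_(b <- s0 | b.1 == y) minn b.2 k)).
  by rewrite -eq_sum leq_add2l.
have le_n u (B : 'M[C]_n) b : hsim B (J u) -> b \in u -> (b.2 <= n)%N.
  by move=> Bu bu; rewrite (hsim_size Bu) jdimE (big_rem b) //= leq_addr.
apply: (@perm_of_minn C _ _ (map f L)) => // [|y|y|_ k /mapP[x xL ->]].
- by rewrite all_map.
- by rewrite fL mem_undup.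
- by rewrite -map_comp => /mapP[b bs ->]; rewrite (map_f f) // mem_undup map_f.
(* Nullities are stationary from k = n on, because no block is larger. *)
have trunc u (B : 'M[C]_n) a : hsim B (J u) ->
    (\sum_(b <- u | b.1 == a) minn b.2 k = \sum_(b <- u | b.1 == a) minn b.2 (minn k n))%N.
  move=> Bu; rewrite big_seq_cond [RHS]big_seq_cond; apply: eq_bigr => b /andP[bu _].
  by rewrite [minn k n]minnC minnA (minn_idPl (le_n u B b Bu bu)).
rewrite (trunc _ _ _ As) eq_null ?geq_minr // -(trunc _ _ _ As0) big_map /=.
rewrite big_seq_cond [RHS]big_seq_cond; apply: eq_bigl => b.
case bs: (b \in s0) => //=; apply/eqP/eqP => [-> //|/fI]; apply => //.
by rewrite mem_undup map_f.
Qed.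

End Matching.

Section LipschitzSimilarity.
Variable R : realType.
Local Notation C := R[i].
Local Notation J := (bdiag (@jblock C)).
Local Notation eigs s := (undup [seq b.1 | b <- s]).

Lemma tr_commutator n (E A0 S : 'M[C]_n) : E *m A0 = A0 *m E ->
  \tr (E *m (A0 *m S)) = \tr (E *m (S *m A0)).
Proof. by move=> cE; rewrite mulmxA cE -mulmxA mxtrace_mulC mulmxA. Qed.

(** By A S = S (A0 + sum_y c_y E_y), the matrix (A - A0) S is the sum of a
    commutator S A0 - A0 S and of sum_y c_y S E_y.  Multiplied by E_x, which
    commutes with A0, the first has trace 0, and of the second only
    c_x tr(E_x S) remains.  This trace is near tr E_x, which is at least 1. *)
Lemma eigenvalue_shift_lipschitz n (A0 A S : 'M[C]_n) (L : seq C)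
    (E : C -> 'M[C]_n) (c : C -> C) (M : R) x :
  (forall y, E y *m A0 = A0 *m E y) ->
  (forall y z, E y *m E z = if y == z then E y else 0) ->
  uniq L -> x \in L -> 1 <= normc (\tr (E x)) -> l1norm (E x) <= M ->
  A *m S = S *m (A0 + \sum_(y <- L) c y *: E y) ->
  l1norm S <= l1norm (1%:M : 'M[C]_n) + 1 -> M * l1norm (S - 1%:M) <= 2^-1 ->
  normc (c x) <= 2 * M * (l1norm (1%:M : 'M[C]_n) + 1) * l1norm (A - A0).
Proof.
move=> cE EE uL xL trE EM AS; set e := l1norm 1%:M + 1 => Se S1.
have M0 : 0 <= M by apply: le_trans EM; apply: l1norm_ge0.
have trace_eq : \tr (E x *m ((A - A0) *m S)) = c x * \tr (E x *m S).
  rewrite mulmxBl mulmxBr linearB /= (tr_commutator _ (cE x)) AS mulmxDr mulmxDr.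
  rewrite linearD /= addrAC subrr add0r mulmx_sumr mulmx_sumr raddf_sum /=.
  rewrite (bigD1_seq x) //= big1 => [|y yx].
    rewrite addr0 -!scalemxAr linearZ /= mulmxA mxtrace_mulC mulmxA EE eqxx //.
  rewrite -!scalemxAr linearZ /= mulmxA mxtrace_mulC mulmxA EE (negPf yx).
  by rewrite mul0mx mxtrace0 mulr0.
have small : normc (\tr (E x *m (S - 1%:M))) <= 2^-1.
  apply: le_trans (l1norm_tr _) (le_trans (l1normM _ _) (le_trans _ S1)).
  by rewrite ler_wpM2r ?l1norm_ge0.
have large : 2^-1 <= normc (\tr (E x *m S)).
  have := normcD (\tr (E x *m S)) (- \tr (E x *m (S - 1%:M))).
  rewrite normc_opp -linearB /= -mulmxBr opprB addrC subrK mulmx1; lra.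
have upper : normc (c x * \tr (E x *m S)) <= M * (l1norm (A - A0) * e).
  rewrite -trace_eq; apply: le_trans (l1norm_tr _) (le_trans (l1normM _ _) _).
  rewrite ler_pM ?l1norm_ge0 // (le_trans (l1normM _ _)) // ler_wpM2l ?l1norm_ge0 //.
rewrite normcM in upper.
have := ler_wpM2l (normc_ge0 (c x)) large.
lra.
Qed.

(** The idempotents give a similar matrix B, a polynomial in A0, whose distance to
    A0 is first only known to be small.  That suffices for an intertwiner S near
    1, by which the eigenvalue shifts are Lipschitz; the estimate of S is then
    improved accordingly. *)
Lemma lipschitz_similarity n (A0 : 'M[C]_n) s0 :
  hsim A0 (J s0) -> all (fun b => 0 < b.2)%N s0 ->
  exists K d : R, [/\ 0 < K, 0 < d & forall A s, l1norm (A - A0) <= d ->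
    hsim A (J s) -> all (fun b => 0 < b.2)%N s ->
    size (eigs s) = size (eigs s0) ->
    (forall k, \sum_(b <- s) minn b.2 k = \sum_(b <- s0) minn b.2 k)%N ->
    exists S q, [/\ A *m S = S *m peval A0 q, S \in unitmx &
                    l1norm (S - 1%:M) <= K * l1norm (A - A0)]].
Proof.
move=> As0 s0_gt0; set L := eigs s0.
have [e [EE trE simE]] := spectral_family As0 s0_gt0.
pose E x := peval A0 (e x).
pose M := \sum_(x <- L) l1norm (E x).
have M0 : 0 <= M by apply: sumr_ge0 => *; apply: l1norm_ge0.
have EM x : x \in L -> l1norm (E x) <= M.
  by move=> xL; rewrite /M (big_rem x) //= lerDl sumr_ge0 // => *; apply: l1norm_ge0.
have [K0 K0_gt K0P] := intertwiner_near_1 A0.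
pose l : R := (size L)%:R; have l0 : 0 <= l by apply: ler0n.
(* While |A - A0| + |B - A0| <= t, the intertwiner has |S - 1| <= K0 t, and tE
   makes both K0 t and M K0 t at most 1/2; eta keeps |B - A0| below t / 2. *)
pose t := (2 * K0 * (M + 1))^-1.
have t0 : 0 < t by rewrite invr_gt0 !mulr_gt0 // ltr_wpDl.
have tE : K0 * t * (M + 1) = 2^-1.
  by rewrite /t; field; rewrite !gt_eqF // ltr_wpDl.
pose eta := t / (2 * (l * M + 1)).
have lM0 : 0 <= l * M by rewrite mulr_ge0.
have eta0 : 0 < eta by rewrite divr_gt0 // mulr_gt0 // ltr_wpDl.
have [d d0 dP] := similar_near As0 s0_gt0 eta0.
pose u := l1norm (1%:M : 'M[C]_n) + 1.
have u0 : 0 <= u by rewrite addr_ge0 ?l1norm_ge0.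
pose K1 := 2 * M * u.
have K10 : 0 <= K1 by rewrite !mulr_ge0.
exists (K0 * (1 + l * K1 * M)), (Num.min d (t / 2)); split.
- by rewrite mulr_gt0 // ltr_pwDl // !mulr_ge0.
- by rewrite lt_min d0 divr_gt0.
move=> A s; rewrite le_min => /andP[Ad At] As s_gt0 sizeL sums.
have [f fnear Af] := dP A s Ad As s_gt0 sizeL sums.
pose c x := f x - x; pose B := A0 + \sum_(x <- L) c x *: E x.
have [q Bq] : exists q, B = peval A0 q.
  exists ('X + \sum_(x <- L) (c x)%:P * e x); rewrite pevalD pevalX; congr (_ + _).
  elim: (L) => [|x r IH]; first by rewrite !big_nil -[0 in RHS]/(0%:P) pevalC raddf0.
  by rewrite !big_cons pevalD pevalM pevalC mul_scalar_mx IH.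
have [W Wu AW] := hsim_sq (hsim_trans Af (hsim_sym (simE f))).
have cAB X : A0 *m X = X *m A0 -> B *m X = X *m B.
  by rewrite Bq; apply: peval_intertwine.
have BA0 h : {in L, forall x, normc (c x) <= h} -> l1norm (B - A0) <= l * h * M.
  move=> ch; rewrite /B addrC addKr; apply: le_trans (l1norm_sum _ _) _.
  have h0 : (0 < size L)%N -> 0 <= h.
    by case: (L) ch => // x r ch _; apply: le_trans (ch x (mem_head _ _)); apply: normc_ge0.
  apply: (@le_trans _ _ (\sum_(x <- L) h * M)).
    rewrite big_seq [leRHS]big_seq; apply: ler_sum => x xL; rewrite l1normZ.
    by rewrite ler_pM ?normc_ge0 ?l1norm_ge0 ?ch ?EM.
  by rewrite big_const_seq count_predT iter_addr_0 -mulrA mulr_natl.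
have BA0_t : l1norm (B - A0) <= t / 2.
  apply: le_trans (BA0 _ fnear) _; rewrite /eta mulrAC mulrA.
  rewrite ler_pdivrMr ?mulr_gt0 ?ltr_wpDl //.
  by have := t0; nra.
have d_ge := l1norm_ge0 (A - A0); have B_ge := l1norm_ge0 (B - A0).
have K0t : K0 * (l1norm (A - A0) + l1norm (B - A0)) <= K0 * t by rewrite ler_pM2l //; lra.
have K0t0 : 0 < K0 * t by rewrite mulr_gt0.
have K0tM : 0 <= K0 * t * M by rewrite mulr_ge0 // ltW.
have [|S AS Snear] := K0P A B W Wu AW cAB; first by lra.
have S_t : l1norm (S - 1%:M) <= K0 * t by apply: le_trans Snear K0t.
have SE : S = 1%:M + (S - 1%:M) by rewrite addrC subrK.
have cK1 : {in L, forall x, normc (c x) <= K1 * l1norm (A - A0)}.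
  move=> x xL; have [k k0 trk] := trE x xL.
  apply: (eigenvalue_shift_lipschitz (L := L) (E := E) (S := S)) => //.
  - by move=> y; rewrite /E (@peval_intertwine _ _ _ A0 A0 A0).
  - exact: undup_uniq.
  - by rewrite trk normc_nat ler1n.
  - exact: EM.
  - by rewrite SE; apply: le_trans (l1normD _ _) _; rewrite lerD2l; lra.
  - have := ler_wpM2l M0 S_t; lra.
exists S, q; split.
- by rewrite -Bq.
- by rewrite SE; apply: unitmx_1D; lra.
apply: le_trans Snear _; rewrite -mulrA ler_pM2l // mulrDl mul1r lerD2l.
by apply: le_trans (BA0 _ cK1) _; lra.
Qed.

End LipschitzSimilarity.

Section SchurTransport.
Variable R : realType.
Local Notation C := R[i].

(** * From an intertwiner to a Schur decomposition *)
Lemma unitarymx_mulVx n (U : 'M[C]_n) : U \is unitarymx -> U^t* *m U = 1%:M.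
Proof. by rewrite -trmxC_unitary => /unitarymxP; rewrite trmxCK. Qed.

(** Write S U0 = U0 Y with Y = U0^* S U0 near 1, and Y = Q R with Q unitary and
    near 1 and R upper triangular.  In the basis S U0 the matrix A has the
    triangular form q(T0), hence in the basis U0 Q the form R q(T0) R^-1. *)
Lemma schur_of_intertwiner n : exists2 K : R, 0 < K &
  forall (A A0 U0 T0 S : 'M[C]_n) q, schur_decomposition A0 U0 T0 ->
  A *m S = S *m peval A0 q -> S \in unitmx -> K * l1norm (S - 1%:M) <= 1 ->
  exists U T, schur_decomposition A U T /\ l1norm (U - U0) <= K * l1norm (S - 1%:M).
Proof.
pose c : R := (n * n)%:R; have c0 : 0 <= c by apply: ler0n.
have [K1 K10 K1P] := lq_near_1 R n.
have cc0 : 0 <= c * c by rewrite mulr_ge0.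
have ccc0 : 0 <= c * K1 * (c * c) by rewrite !mulr_ge0 // ltW.
exists (2 * (c * c) + c * K1 * (c * c) + 1) => [|A A0 U0 T0 S q]; first by lra.
move=> [U0u T0t A0E] AS Su; set h := l1norm (S - 1%:M) => small.
have h0 : 0 <= h by apply: l1norm_ge0.
have cch : 0 <= c * c * h by rewrite mulr_ge0.
have ccch : 0 <= c * K1 * (c * c) * h by rewrite mulr_ge0.
have U0U0 := unitarymx_mulVx U0u.
pose Y := U0^t* *m S *m U0.
have SU0 : S *m U0 = U0 *m Y by rewrite /Y !mulmxA (unitarymxP U0u) mul1mx.
have Y1 : l1norm (Y - 1%:M) <= c * c * h.
  have -> : Y - 1%:M = U0^t* *m (S - 1%:M) *m U0.
    by rewrite mulmxBr mulmx1 mulmxBl U0U0.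
  apply: le_trans (l1normM _ _) _; rewrite [leRHS]mulrAC.
  rewrite ler_pM ?l1norm_ge0 ?l1norm_unitary // (le_trans (l1normM _ _)) //.
  by rewrite ler_wpM2r // l1norm_trC l1norm_unitary.
have YT1 : l1norm (Y^T - 1%:M) = l1norm (Y - 1%:M).
  by rewrite -[RHS]l1norm_trmx linearB /= trmx1.
have [|L [V [Vu Lt Lu YLV V1]]] := K1P (Y^T); first by rewrite YT1; lra.
have {}YLV : Y = V^T *m L^T by rewrite -trmx_mul -YLV trmxK.
have LTu : L^T \in unitmx by rewrite unitmx_tr.
have U0T0 : A0 *m U0 = U0 *m T0 by rewrite A0E -!mulmxA U0U0 mulmx1.
have := peval_trig q T0t; rewrite -peval_trmx => T't.
pose U := U0 *m V^T; pose T := L^T *m peval T0 q *m invmx L^T.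
have Uu : U0 *m V^T \is unitarymx.
  by apply: (mul_unitarymx U0u); rewrite trmx_unitary.
exists U, T; split.
  split; first exact: Uu.
    rewrite /T !trmx_mul trmx_inv trmxK.
    exact: trig_mx_mul (trig_mx_inv Lt Lu) (trig_mx_mul T't Lt).
  have AU : A *m U = U *m T.
    have UL : U *m L^T = S *m U0 by rewrite /U -mulmxA -YLV SU0.
    rewrite -[LHS](mulmxK LTu) -(mulmxA A) UL mulmxA AS -(mulmxA S).
    by rewrite (peval_intertwine q U0T0) mulmxA -UL /T !mulmxA.
  by rewrite -AU -mulmxA (unitarymxP Uu) mulmx1.
have -> : U - U0 = U0 *m (V - 1%:M)^T.
  by rewrite linearB /= trmx1 mulmxBr mulmx1.
apply: le_trans (l1normM _ _) _; rewrite l1norm_trmx.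
have V_le : l1norm (V - 1%:M) <= K1 * (c * c * h).
  by apply: le_trans V1 _; rewrite YT1 ler_pM2l.
have := ler_pM (l1norm_ge0 U0) (l1norm_ge0 (V - 1%:M)) (l1norm_unitary U0u) V_le.
by rewrite -/c; lra.
Qed.

(** T = U^* A U is a product of three factors, so the difference splits into
    three terms. *)
Lemma schur_factor_lipschitz n (A A0 U U0 T T0 : 'M[C]_n) :
  schur_decomposition A U T -> schur_decomposition A0 U0 T0 ->
  l1norm (T - T0) <= (n * n)%:R * (l1norm A + l1norm A0) * l1norm (U - U0)
                  + (n * n)%:R ^+ 2 * l1norm (A - A0).
Proof.
have conjE (B V X : 'M[C]_n) : V \is unitarymx -> B = V *m X *m V^t* ->
    X = V^t* *m B *m V.
  move=> /unitarymx_mulVx VV ->; by rewrite !mulmxA VV mul1mx -mulmxA VV mulmx1.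
move=> [Uu _ AE] [U0u _ A0E]; rewrite (conjE _ _ _ Uu AE) (conjE _ _ _ U0u A0E).
set c : R := (n * n)%:R; have c0 : 0 <= c by apply: ler0n.
have Uc : l1norm (U^t*) <= c by rewrite l1norm_trC; apply: l1norm_unitary Uu.
have U0c : l1norm U0 <= c by apply: l1norm_unitary U0u.
have UU : l1norm (U^t* - U0^t*) = l1norm (U - U0).
  rewrite -[RHS]l1norm_trC; congr l1norm.
  by apply/matrixP => i j; rewrite !mxE rmorphB.
have -> : U^t* *m A *m U - U0^t* *m A0 *m U0 =
    U^t* *m A *m (U - U0) + (U^t* *m (A - A0) *m U0 + (U^t* - U0^t*) *m A0 *m U0).
  by rewrite !(mulmxBl, mulmxBr) !addrA subrK subrK.
have h1 : l1norm (U^t* *m A *m (U - U0)) <= c * l1norm A * l1norm (U - U0).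
  apply: le_trans (l1normM _ _) _; rewrite ler_wpM2r ?l1norm_ge0 //.
  by apply: le_trans (l1normM _ _) _; rewrite ler_wpM2r ?l1norm_ge0.
have h2 : l1norm (U^t* *m (A - A0) *m U0) <= c * l1norm (A - A0) * c.
  apply: le_trans (l1normM _ _) _; rewrite ler_pM ?l1norm_ge0 //.
  by apply: le_trans (l1normM _ _) _; rewrite ler_wpM2r ?l1norm_ge0.
have h3 : l1norm ((U^t* - U0^t*) *m A0 *m U0) <= l1norm (U - U0) * l1norm A0 * c.
  apply: le_trans (l1normM _ _) _; rewrite ler_pM ?l1norm_ge0 //.
  by rewrite -UU l1normM.
apply: le_trans (l1normD _ _) _.
have := le_trans (l1normD (U^t* *m (A - A0) *m U0) ((U^t* - U0^t*) *m A0 *m U0)) (lerD h2 h3).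
lra.
Qed.

End SchurTransport.

Theorem theorem1p3 (R : realType) (n : nat) (A0 : 'M[R[i]]_n) :
  exists K eps : R, 0 < K /\ 0 < eps /\
    forall U0 T0 : 'M[R[i]]_n, schur_decomposition A0 U0 T0 ->
    forall Om : seq (seq nat), jordan_structure A0 Om ->
    forall A : 'M[R[i]]_n, jordan_class Om A -> opnorm (A - A0) < eps ->
    exists U T : 'M[R[i]]_n,
      schur_decomposition A U T /\
      opnorm (U - U0) + opnorm (T - T0) <= K * opnorm (A - A0).
Proof.
have [[Om0 A0Om]|none] := pselect (exists Om, jordan_structure A0 Om); last first.
  by exists 1, 1; do 2![split=> //] => U0 T0 _ Om A0Om; case: none; exists Om.
have [s0 [As0 s0_gt0 _ _]] := jordan_structureP A0Om.
have [K1 [d [K1_gt d_gt K1P]]] := lipschitz_similarity As0 s0_gt0.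
have [K2 K2_gt K2P] := schur_of_intertwiner R n.
pose c : R := (n * n)%:R; have c0 : 0 <= c by apply: ler0n.
have A0_ge := l1norm_ge0 A0.
pose eta := Num.min 1 (Num.min d (K1 * K2)^-1).
have eta0 : 0 < eta by rewrite !lt_min ltr01 d_gt invr_gt0 mulr_gt0.
pose KU := K2 * K1; have KU0 : 0 < KU by rewrite mulr_gt0.
pose KT := c * (2 * l1norm A0 + 1) * KU + c ^+ 2.
have KT0 : 0 <= KT.
  by rewrite addr_ge0 ?exprn_ge0 // !mulr_ge0 ?(ltW KU0) //; lra.
exists ((KU + KT) * c + 1), (eta / (c + 1)); split.
  by rewrite ltr_wpDl // mulr_ge0 // addr_ge0 // ltW.
split; first by rewrite divr_gt0 // ltr_wpDl.
move=> U0 T0 S0 Om AOm A /jordan_structureP[s [As s_gt0 sizes sums]] near.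
have [s1 [As1 s1_gt0 sizes1 sums1]] := jordan_structureP AOm.
have op_ge := opnorm_ge0 (A - A0).
set dA := opnorm (A - A0) in near op_ge *.
(* The factor c converts the operator norm into the l1 norm; in delta_eta the
   denominator c + 1 replaces c, which vanishes for n = 0. *)
have delta_le : l1norm (A - A0) <= c * dA by apply: l1norm_le_opnorm.
have delta_eta : l1norm (A - A0) <= eta.
  by rewrite ltr_pdivlMr ?ltr_wpDl // in near; lra.
move: (delta_eta); rewrite !le_min => /and3P[delta1 delta_d delta_K].
have eigs_eq : size (undup [seq b.1 | b <- s]) = size (undup [seq b.1 | b <- s0]).
  rewrite sizes -sizes1; apply: perm_size; apply: uniq_perm; rewrite ?undup_uniq //.
  by move=> x; rewrite (eigenvalues_jordan As1) // (eigenvalues_jordan As0).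
have sums_eq k : (\sum_(b <- s) minn b.2 k = \sum_(b <- s0) minn b.2 k)%N.
  have ueigs := undup_uniq [seq b.1 | b <- s0].
  have eigsA0 := eigenvalues_jordan As0 s0_gt0.
  rewrite sums -sums1 (sum_minn_nullity k As1 s1_gt0 ueigs eigsA0).
  by rewrite (sum_minn_nullity k As0 s0_gt0 ueigs eigsA0).
have [S [q [AS Su S1]]] := K1P A s delta_d As s_gt0 eigs_eq sums_eq.
have delta0 := l1norm_ge0 (A - A0).
have S1K : K2 * l1norm (S - 1%:M) <= KU * l1norm (A - A0).
  by rewrite -mulrA ler_pM2l.
have [|U [T [UT UU0]]] := K2P A A0 U0 T0 S q S0 AS Su.
  apply: le_trans S1K _; rewrite /KU mulrC [K2 * K1]mulrC.
  by rewrite -ler_pdivlMr ?mulr_gt0 // mul1r.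
exists U, T; split; first exact: UT.
have {}UU0 := le_trans UU0 S1K.
have A_le : l1norm A <= l1norm A0 + 1.
  by rewrite -[A](subrK A0) addrC; apply: le_trans (l1normD _ _) _; rewrite lerD2l.
have TT0 : l1norm (T - T0) <= KT * l1norm (A - A0).
  apply: le_trans (schur_factor_lipschitz UT S0) _.
  have cA0 : 0 <= c * (l1norm A + l1norm A0) by rewrite mulr_ge0 // addr_ge0 ?l1norm_ge0.
  have cA : c * (l1norm A + l1norm A0) <= c * (2 * l1norm A0 + 1) by rewrite ler_wpM2l //; lra.
  have := ler_pM cA0 (l1norm_ge0 _) cA UU0; rewrite -/c /KT; lra.
apply: le_trans (lerD (opnorm_le_l1norm _) (opnorm_le_l1norm _)) _.
apply: le_trans (lerD UU0 TT0) _; rewrite -mulrDl.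
have KUT : 0 <= KU + KT by rewrite addr_ge0 // ltW.
have := ler_wpM2l KUT delta_le; lra.
Qed.
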